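(* Let $(\mathcal{A},\varphi)$ be a noncommutative probability space and let $\{h_n\colon \mathcal{A}^n\to\mathbb{C}\}_{n\geq 1}$ be the family of monotone cumulants of $(\mathcal{A},\varphi)$. Then, for any $n\geq 1$ and any elements $a_1,\dots,a_n\in\mathcal{A}$, $$h_n(a_1,\dots,a_n)=\sum_{t\in \mathrm{ST}(n)}\omega(\mathrm{sk}(t))\,\varphi_{\pi(t)}(a_1,\dots,a_n),$$ where $\mathrm{ST}(n)$ is the set of Schröder trees with $n+1$ leaves, $\mathrm{sk}(t)$ is the skeleton of $t$, $\omega$ is the Murua coefficient, and $\pi(t)$ is the noncrossing partition associated to $t$.
   Context: Noncommutative probability space: a pair $(\mathcal{A},\varphi)$ with $\mathcal{A}$ a unital (associative) algebra over $\mathbb{C}$ and $\varphi\colon\mathcal{A}\to\mathbb{C}$ linear with $\varphi(1_{\mathcal{A}})=1$. Put $\varphi_n(a_1,\dots,a_n)=\varphi(a_1\cdots a_n)$ (product in $\mathcal{A}$). Noncrossing partitions: $\mathrm{NC}(n)$ is the set of set partitions $\pi$ of $[n]=\{1,\dots,n\}$ such that there are no $a<b<c<d$ with $a,c$ in one block and $b,d$ in another, different block. For a family of multilinear functionals $\{f_n\colon\mathcal{A}^n\to\mathbb{C}\}_{n\ge1}$ and $\pi\in\mathrm{NC}(n)$, set $f_\pi(a_1,\dots,a_n)=\prod_{V\in\pi}f_{|V|}(a_1,\dots,a_n|V)$, where for $V=\{i_1<\dots<i_s\}$, $f_{|V|}(a_1,\dots,a_n|V)=f_s(a_{i_1},\dots,a_{i_s})$.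 In particular $\varphi_\pi$ is obtained from $\{\varphi_n\}$. Forest of nestings: for blocks $V,W$ of $\pi\in\mathrm{NC}(n)$ write $V\le W$ if every element of $W$ lies in the interval $[\min V,\max V]$. The forest of nestings $t(\pi)$ is the forest of rooted trees whose vertices are the blocks of $\pi$, with an edge from $V$ to $W$ (so $W$ is a child of $V$) iff $V<W$ and there is no block $U$ with $V<U<W$; the roots are the minimal blocks. Tree factorial: $t!=1$ if $t$ is a single vertex; if $t$ is obtained by grafting subtrees $s_1,\dots,s_m$ to a root, $t!=|t|\,s_1!\cdots s_m!$, where $|t|$ is the number of vertices; for a forest, $f!$ is the product of the factorials of its trees. Monotone cumulants: the multilinear functionals $\{h_n\colon\mathcal{A}^n\to\mathbb{C}\}_{n\ge1}$ defined recursively by $\varphi_n(a_1,\dots,a_n)=\sum_{\pi\in\mathrm{NC}(n)}\frac{1}{t(\pi)!}h_\pi(a_1,\dots,a_n)$ for all $n\ge1$ and $a_i\in\mathcal{A}$. Schröder trees: planar rooted trees in which every internal (non-leaf) vertex has at least two children; $\mathrm{ST}(n)$ is the set of those with $n+1$ leaves. Partition $\pi(t)$: for $t\in\mathrm{ST}(n)$ label the $n$ sectors between consecutive leaves, from left to right, by $1,\dots,n$. For each internal vertex $v$, consider the corolla formed by $v$ and its children; the sectors between consecutive children of $v$ form a block of $\pi(t)$ (equivalently, $i$ is in the block of $v$ iff $v$ is the last common ancestor of the $i$-th and $(i+1)$-st leaves). Then $\pi(t)\in\mathrm{NC}(n)$, with one block for each internal vertex. Skeleton: $\mathrm{sk}(t)$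 is the planar rooted tree whose vertices are the internal vertices of $t$, with $w$ a child of $v$ in $\mathrm{sk}(t)$ iff $w$ is a child of $v$ in $t$. Murua coefficients: a rooted tree $s$ is viewed as a poset with $v<w$ iff $v\neq w$ and $v$ lies on the path from the root to $w$. For a rooted tree $s$ with $|s|$ vertices and $1\le k\le|s|$, $\omega_k(s)$ is the number of surjective functions $f\colon s\to\{1,\dots,k\}$ such that $v<w$ implies $f(v)<f(w)$; and $\omega(s)=\sum_{k=1}^{|s|}\frac{(-1)^{k+1}}{k}\omega_k(s)$. *)

(* Defs.v *)
From HB Require Import structures.
From mathcomp Require Import all_boot all_order all_algebra.
From mathcomp Require Import reals.
From mathcomp Require Import complex.

Set Implicit Arguments.
Unset Strict Implicit.
Unset Printing Implicit Defensive.

Import Order.TTheory GRing.Theory Num.Theory.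

(* A leaf is a node without children. *)
Inductive tree := Node of seq tree.

Definition children (t : tree) : seq tree := let: Node ss := t in ss.

Definition is_leaf (t : tree) : bool := nilp (children t).

Fixpoint tree_ind' (P : tree -> Prop)
    (H : forall ss, (forall i, i < size ss -> P (nth (Node [::]) ss i)) ->
         P (Node ss)) (t : tree) : P t :=
  let: Node ss := t in
  H ss ((fix go (ss : seq tree) :
          forall i, i < size ss -> P (nth (Node [::]) ss i) :=
    match ss return forall i, i < size ss -> P (nth (Node [::]) ss i) with
    | [::] => fun i (h : i < 0) => False_ind _ (notF h)
    | s :: ss' => fun i =>
      match i return i < size (s :: ss') ->
                     P (nth (Node [::]) (s :: ss') i) with
      | 0 => fun _ => tree_ind' H s
      | j.+1 => go ss' j
      end
    end) ss).

Fixpoint tree_encode (t : tree) : GenTree.tree void :=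
  let: Node ss := t in GenTree.Node 0 (map tree_encode ss).

Fixpoint tree_decode (u : GenTree.tree void) : tree :=
  match u with
  | GenTree.Leaf _ => Node [::]
  | GenTree.Node _ us => Node (map tree_decode us)
  end.

Lemma tree_encodeK : cancel tree_encode tree_decode.
Proof.
elim/tree_ind' => ss IH /=; congr Node; rewrite -map_comp.
apply: (@eq_from_nth _ (Node [::])); rewrite ?size_map // => i lti.
by rewrite (nth_map (Node [::])) //= IH.
Qed.

HB.instance Definition _ := Countable.copy tree (can_type tree_encodeK).

(* A vertex is represented by its address, the sequence of child positions on
   the path from the root. *)
Definition addresses_below (L : seq (seq (seq nat))) : seq (seq nat) :=
  [seq i :: p | i <- iota 0 (size L), p <- nth [::] L i].

Fixpoint vertices (t : tree) : seq (seq nat) :=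
  let: Node ss := t in [::] :: addresses_below (map vertices ss).

(* Listed from left to right. *)
Fixpoint leaves (t : tree) : seq (seq nat) :=
  let: Node ss := t in
  if ss is [::] then [:: [::]] else addresses_below (map leaves ss).

Definition internal_vertices (t : tree) : seq (seq nat) :=
  [seq v <- vertices t | v \notin leaves t].

Definition tree_size (t : tree) : nat := size (vertices t).

Fixpoint tree_fact (t : tree) : nat :=
  let: Node ss := t in tree_size t * foldr muln 1 (map tree_fact ss).

Definition forest_fact (ts : seq tree) : nat := \prod_(t <- ts) tree_fact t.

Definition below (v w : seq nat) : bool := (v != w) && prefix v w.

Definition murua_k (k : nat) (s : tree) : nat :=
  #|[set f : {ffun seq_sub (vertices s) -> 'I_k} |
      [forall j, exists v, f v == j] &&
      [forall v, forall w, below (val v) (val w) ==> (f v < f w)]]|.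

Definition murua (s : tree) : rat :=
  (\sum_(1 <= k < (tree_size s).+1)
     (-1) ^+ k.+1 / k%:R * (murua_k k s)%:R)%R.

Fixpoint is_schroder (t : tree) : bool :=
  let: Node ss := t in
  (nilp ss || (1 < size ss)) && all is_schroder ss.

Record schroder_tree (n : nat) := SchroderTree {
  schroder_val :> tree;
  _ : is_schroder schroder_val && (size (leaves schroder_val) == n.+1)
}.

HB.instance Definition _ n := [isSub for @schroder_val n].
HB.instance Definition _ n := [Countable of schroder_tree n by <:].

Fixpoint seqs_upto (T : Type) (s : seq T) (m : nat) : seq (seq T) :=
  if m is m'.+1 then
    [::] :: [seq x :: l | x <- s, l <- seqs_upto s m']
  else [:: [::]].

Fixpoint trees_upto (d m : nat) : seq tree :=
  if d is d'.+1 then map Node (seqs_upto (trees_upto d' m) m) else [::].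

Lemma mem_seqs_upto (T : eqType) (s l : seq T) m :
  size l <= m -> all (mem s) l -> l \in seqs_upto s m.
Proof.
elim: m l => [|m IH] [|x l] //= lem /andP[xs ls].
by rewrite inE; apply/allpairsPdep; exists x, l; split=> //; apply: IH.
Qed.

Lemma size_addresses_below L :
  size (addresses_below L) = sumn [seq size l | l <- L].
Proof.
rewrite size_allpairs_dep; congr sumn.
apply: (@eq_from_nth _ 0); rewrite !size_map ?size_iota // => i lti.
by rewrite (nth_map 0) ?size_iota // nth_iota // (nth_map [::]).
Qed.

Lemma size_leaves_gt0 t : 0 < size (leaves t).
Proof.
elim/tree_ind': t => -[|s ss] IH //=.
by rewrite size_addresses_below /= (leq_trans (IH 0 _)) // leq_addr.
Qed.

Lemma mem_trees_upto d m t :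
  is_schroder t -> size (leaves t) <= d -> size (leaves t) <= m ->
  t \in trees_upto d m.
Proof.
elim: d t => [|d IH] [ss]; first by rewrite leqNgt size_leaves_gt0.
move=> /= /andP[ss2 ssS] led lem; apply: map_f.
have [->|ssN] := eqVneq ss [::]; first by case: (m).
have {}ss2 : 1 < size ss by case: (ss) ssN ss2.
have El : size (leaves (Node ss)) = \sum_(s <- ss) size (leaves s).
  transitivity (size (addresses_below (map leaves ss))); first by case: (ss) ssN.
  by rewrite size_addresses_below sumnE !big_map.
move: led lem; rewrite -/(leaves (Node ss)) El => led lem.
have sumP (l : seq tree) : size l <= \sum_(s <- l) size (leaves s).
  elim: l => [|s l IHl]; rewrite ?big_nil // big_cons /=.
  by rewrite -(add1n (size l)) leq_add // size_leaves_gt0.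
apply: mem_seqs_upto; first exact: leq_trans (sumP ss) lem.
apply/allP => s sss /=.
have ls : size (leaves s) < \sum_(s <- ss) size (leaves s).
  rewrite (big_rem s) //= -addn1 leq_add2l; apply: leq_trans (sumP _).
  by rewrite size_rem // -ltnS prednK // ltnW.
apply: IH; first exact: (allP ssS).
  by rewrite -ltnS (leq_trans ls).
exact: ltnW (leq_trans ls lem).
Qed.

Lemma schroder_tree_enumP n : Finite.axiom
  (undup (pmap (insub : tree -> option (schroder_tree n)) (trees_upto n.+1 n.+1))).
Proof.
apply: Finite.uniq_enumP; first exact: undup_uniq.
move=> t; rewrite mem_undup mem_pmap_sub.
have /andP[tS /eqP tn] := valP t.
by apply: mem_trees_upto; rewrite ?tn.
Qed.

HB.instance Definition _ n :=
  isFinite.Build (schroder_tree n) (@schroder_tree_enumP n).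

(* Meaningful when [t] is not a leaf. *)
Fixpoint skeleton (t : tree) : tree :=
  let: Node ss := t in
  Node (pmap (fun s => if is_leaf s then None else Some (skeleton s)) ss).

(* The last common ancestor of two vertices. *)
Fixpoint lca (u v : seq nat) : seq nat :=
  match u, v with
  | x :: u', y :: v' => if x == y then x :: lca u' v' else [::]
  | _, _ => [::]
  end.

(* With leaves and sectors numbered from 0, sector [i] lies between the leaves
   [i] and [i.+1]. *)
Definition sector_block (n : nat) (t : tree) (v : seq nat) : {set 'I_n} :=
  [set i : 'I_n | lca (nth [::] (leaves t) i) (nth [::] (leaves t) i.+1) == v].

Definition tree_partition (n : nat) (t : tree) : {set {set 'I_n}} :=
  [set:: [seq sector_block n t v | v <- internal_vertices t]].

Section NoncrossingPartitions.
Variable n : nat.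
Implicit Types (P : {set {set 'I_n}}) (V W : {set 'I_n}).

Definition noncrossing P : bool :=
  [forall V in P, forall W in P, (V != W) ==>
    [forall a in V, forall b in W, forall c in V, forall d in W,
      ~~ [&& a < b, b < c & c < d]]].

Definition NC : {set {set {set 'I_n}}} :=
  [set P | partition P [set: 'I_n] && noncrossing P].

Definition block_min V : nat := \big[minn/n]_(i in V) (i : nat).
Definition block_max V : nat := \max_(i in V) (i : nat).

Definition nest_le V W : bool :=
  [forall i in W, block_min V <= i <= block_max V].

Definition nest_lt V W : bool := (V != W) && nest_le V W.

Definition nest_roots P : {set {set 'I_n}} :=
  [set V in P | ~~ [exists U in P, nest_lt U V]].

Definition nest_children P V : {set {set 'I_n}} :=
  [set W in P | nest_lt V W &&
    ~~ [exists U in P, nest_lt V U && nest_lt U W]].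

Fixpoint nest_tree_rec (k : nat) P V : tree :=
  Node (if k is k'.+1
        then [seq nest_tree_rec k' P W | W <- enum (nest_children P V)]
        else [::]).

(* No chain of blocks is longer than #|P|, so the recursion is never cut off;
   see nest_treeE. *)
Definition nest_tree P V : tree := nest_tree_rec #|P| P V.

Definition nest_forest P : seq tree :=
  [seq nest_tree P V | V <- enum (nest_roots P)].

Lemma block_minP V i : i \in V -> block_min V <= i.
Proof.
move=> iV; rewrite /block_min -minEnat -leEnat.
exact: (bigmin_le_cond _ (fun k : 'I_n => k : nat) iV).
Qed.

Lemma block_min_mem V : V != set0 -> exists2 i, i \in V & block_min V = i.
Proof.
case/set0Pn => j jV; case: (arg_minnP (fun i : 'I_n => i : nat) jV) => i iV imin.
exists i => //; apply/eqP; rewrite eqn_leq block_minP //=.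
rewrite /block_min; elim/big_ind: _ => [|x y ix iy|k kV].
- exact: ltnW (ltn_ord i).
- by rewrite leq_min ix.
- exact: imin.
Qed.

Lemma nest_le_max V W : nest_le V W -> block_max W <= block_max V.
Proof.
move=> /forallP H; apply/bigmax_leqP => i iW.
by have /implyP/(_ iW)/andP[] := H i.
Qed.

Lemma nest_le_min V W : W != set0 -> nest_le V W -> block_min V <= block_min W.
Proof.
case/block_min_mem => i iW -> /forallP/(_ i)/implyP/(_ iW).
by case/andP.
Qed.

Lemma nest_le_trans V W U :
  W != set0 -> nest_le V W -> nest_le W U -> nest_le V U.
Proof.
move=> W0 VW /forallP WU; apply/forallP => i; apply/implyP => iU.
have /implyP/(_ iU)/andP[h1 h2] := WU i.
rewrite (leq_trans (nest_le_min W0 VW)) //=.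
exact: leq_trans h2 (nest_le_max VW).
Qed.

Lemma nest_le_anti P V W : partition P [set: 'I_n] -> V \in P -> W \in P ->
  nest_le V W -> nest_le W V -> V = W.
Proof.
case/and3P=> _ tP P0 VP WP VW WV.
have N0 U : U \in P -> U != set0 by apply: contraTneq => ->.
have [i iV Ei] := block_min_mem (N0 _ VP).
have [j jW Ej] := block_min_mem (N0 _ WP).
have eij : i = j.
  apply/val_inj/eqP; rewrite /= -Ei -Ej eqn_leq.
  by rewrite (nest_le_min (N0 _ WP) VW) (nest_le_min (N0 _ VP) WV).
by rewrite -(def_pblock tP VP iV) eij (def_pblock tP WP jW).
Qed.

Lemma nest_lt_card P V W : partition P [set: 'I_n] -> V \in P -> W \in P ->
  nest_lt V W -> #|[set U in P | nest_lt W U]| < #|[set U in P | nest_lt V U]|.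
Proof.
move=> pP VP WP VW; apply: proper_card; apply/properP; split.
  apply/subsetP => U; rewrite !inE => /andP[UP /andP[WU0 WU]]; rewrite UP /=.
  case/andP: VW => VW0 VW.
  have W0 : W != set0 by case/and3P: pP => _ _; apply: contraNneq => <-.
  rewrite /nest_lt (nest_le_trans W0 VW WU) andbT.
  apply: contraNneq VW0 => EU; rewrite -EU in WU.
  by rewrite (nest_le_anti pP VP WP VW WU).
by exists W; rewrite !inE WP ?VW // /nest_lt eqxx.
Qed.

Lemma nest_tree_rec_eq P V k l : partition P [set: 'I_n] -> V \in P ->
  #|[set U in P | nest_lt V U]| <= k -> #|[set U in P | nest_lt V U]| <= l ->
  nest_tree_rec k P V = nest_tree_rec l P V.
Proof.
move=> pP; elim: k V l => [|k IH] V [|l] VP //.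
- rewrite leqn0 cards_eq0 => /eqP E _ /=.
  suff -> : nest_children P V = set0 by rewrite enum_set0.
  apply/setP => W; rewrite !inE; move/setP/(_ W): E; rewrite !inE.
  by case: (W \in P) => //= ->.
- rewrite leqn0 cards_eq0 => _ /eqP E /=.
  suff -> : nest_children P V = set0 by rewrite enum_set0.
  apply/setP => W; rewrite !inE; move/setP/(_ W): E; rewrite !inE.
  by case: (W \in P) => //= ->.
- move=> lek lel /=; congr Node; apply/eq_in_map => W.
  rewrite mem_enum inE => /and3P[WP VW _].
  have lt := nest_lt_card pP VP WP VW.
  by apply: IH => //; rewrite -ltnS (leq_trans lt).
Qed.

Lemma nest_treeE P V : partition P [set: 'I_n] -> V \in P ->
  nest_tree P V = Node [seq nest_tree P W | W <- enum (nest_children P V)].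
Proof.
move=> pP VP; rewrite /nest_tree.
have lec W : #|[set U in P | nest_lt W U]| <= #|P|.
  by apply/subset_leq_card/subsetP => U; rewrite inE => /andP[].
rewrite (@nest_tree_rec_eq P V _ #|P|.+1) //; exact: leqW.
Qed.

End NoncrossingPartitions.

Local Open Scope ring_scope.

Section Functionals.
Variables (R : realType) (A : algType R[i]).

(* The component of index 0 plays no role. *)
Definition functional_family := forall n : nat, {ffun 'I_n -> A} -> R[i].

Definition replace n (a : {ffun 'I_n -> A}) (i : 'I_n) (x : A) :
    {ffun 'I_n -> A} :=
  [ffun j => if j == i then x else a j].

Definition multilinear n (f : {ffun 'I_n -> A} -> R[i]) : Prop :=
  forall (a : {ffun 'I_n -> A}) (i : 'I_n) (c : R[i]) (x y : A),
    f (replace a i (c *: x + y)) = c * f (replace a i x) + f (replace a i y).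

(* [enum_val] lists the elements of a subset of 'I_n in increasing order. *)
Definition restrict n (a : {ffun 'I_n -> A}) (V : {set 'I_n}) :
    {ffun 'I_#|V| -> A} :=
  [ffun j => a (enum_val j)].

Definition partition_functional (f : functional_family) n
    (P : {set {set 'I_n}}) (a : {ffun 'I_n -> A}) : R[i] :=
  \prod_(V in P) f #|V| (restrict a V).

Definition moment (phi : {scalar A}) : functional_family :=
  fun n a => phi (\prod_(i < n) a i).

Definition monotone_cumulants (phi : {scalar A}) (h : functional_family) :
    Prop :=
  (forall n, (0 < n)%N -> multilinear (@h n)) /\
  (forall n, (0 < n)%N -> forall a : {ffun 'I_n -> A},
    moment phi a = \sum_(P in NC n)
      ((forest_fact (nest_forest P))%:R)^-1 * partition_functional h P a).

End Functionals.

(* Main.v *)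
Require Import Defs.
From mathcomp Require Import all_boot all_order all_algebra ring.
From mathcomp Require Import reals.
From mathcomp Require Import complex.

(** Moments are the exponential of the monotone cumulants for a product of functions on
words, and the theorem computes the logarithm: both sides are the derivative at 0
of the same one-parameter group.

For functions f and g on words, the product [conv f g g w] is the sum, over all
subwords S of w, of f(S) times the product of g over the |S| + 1 gaps that S
leaves in w. It is associative ([convA]). A function h, cut to 0 on the empty
word, generates a family of polynomials [flow h w] that solves F' = h * F with
F(0) equal to the unit of the product. Associativity and uniqueness for this
equation give F_w(X + c) = (F(X) * F(c))_w ([flow_shift]). So with m = F(1), the
value of F at a natural number N is the N-th power of m, and h is the
coefficient of X in F ([flow_coef1]).

- Noncrossing partitions compute F. The tree factorial of the forest of nestings
  is the product over the blocks of the number of blocks nested in them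
  ([forest_fact_hook]), and the hooks of the roots add up to the number of
  blocks. Hence the derivative of the sum of h_pi X^|pi| / t(pi)! removes a root
  block V of pi, which leaves independent noncrossing partitions of the gaps of V:
  this is the equation F' = h * F ([nc_sum_flow]). At X = 1 the definition
  of the monotone cumulants says that m is the moment function ([flow_moment]).

- Schroder trees compute the powers of m. The sectors at the root of a tree form
  a subword and the subtrees sit in its gaps, a leaf being an empty gap
  ([sum_forest_val]). Let Omega(s, N) be the number of strictly increasing maps from s
  to {0, ..., N - 1}. Such a map to {0, ..., N} either takes the value 0, then only
  at the root, or not at all, so that Omega(s, N + 1) = Omega(s, N) + the product of
  Omega(s', N) over the subtrees s' of the root ([order_countS]). So the sum over
  t of Omega(sk(t), N) m_(pi(t)) obeys the recursion of the N-th power of m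
  ([weighted_sumS]).

Sorting strict maps by their images gives Omega(s, N) as the sum of the
omega_k(s) binomial(N, k) ([order_countE]). Both computations of F agree at all natural
numbers, hence as polynomials. The coefficient of X in binomial(X, k) is
(-1)^(k+1) / k, so comparing the coefficients of X gives the theorem
([log_flow]). *)

Set Implicit Arguments.
Unset Strict Implicit.
Unset Printing Implicit Defensive.

Import Order.TTheory GRing.Theory Num.Theory.

(** * Substitution product and flow on words *)

Local Open Scope ring_scope.

Section Convolution.
Variables (T : Type) (K : comNzRingType).
Implicit Types (f g k : seq T -> K) (w : seq T).

(** [conv f g g w] sums, over the subwords S of [w], the value [f S] times the
product of [g] over the gaps of S, the possibly empty gaps at both ends included.
The separate function [g1] for the first gap makes the recursion structural: the
first letter of [w] belongs to S, and then the first gap is empty, or to the first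
gap. *)
Fixpoint conv f g1 g w : K :=
  if w is x :: w' then
    g1 [::] * conv (fun u => f (x :: u)) g g w'
    + conv f (fun u => g1 (x :: u)) g w'
  else f [::] * g1 [::].

Lemma eq_conv f f' g1 g1' g g' w :
    (forall u, size u <= size w -> f u = f' u)%N ->
    (forall u, size u <= size w -> g1 u = g1' u)%N ->
    (forall u, size u <= size w -> g u = g' u)%N ->
  conv f g1 g w = conv f' g1' g' w.
Proof.
elim: w f f' g1 g1' g g' => [|x w IH] f f' g1 g1' g g' ff' gg1 gg' /=.
  by rewrite ff' // gg1.
rewrite gg1 //; congr (_ * _ + _); apply: IH => u leu.
- exact: ff'.
- exact/gg'/leqW.
- exact/gg'/leqW.
- exact/ff'/leqW.
- exact: gg1.
- exact/gg'/leqW.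
Qed.

(** Sorts the subwords by the position of their first letter; the summand in
front is the empty subword, whose only gap is the whole word. *)
Lemma conv_first f g1 g w x0 :
  conv f g1 g w = f [::] * g1 w +
    \sum_(i < size w) g1 (take i w)
      * conv (fun u => f (nth x0 w i :: u)) g g (drop i.+1 w).
Proof.
elim: w f g1 => [|x w IH] f g1 /=; first by rewrite big_ord0 addr0.
by rewrite big_ord_recl /= drop0 [X in _ + X]IH addrCA.
Qed.

(** When [f] vanishes on the empty word, only proper gaps contribute. This drives
the inductions on the length of words. *)
Lemma eq_conv_lt f g1 g1' g g' w : f [::] = 0 ->
    (forall u, size u < size w -> g1 u = g1' u)%N ->
    (forall u, size u < size w -> g u = g' u)%N ->
  conv f g1 g w = conv f g1' g' w.
Proof.
case: w => [|x0 w] f0 gg1 gg'; first by rewrite /= f0 !mul0r.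
rewrite !(conv_first _ _ _ _ x0) f0 !mul0r; congr (_ + _).
apply: eq_bigr => i _; rewrite gg1; last by rewrite size_take_min gtn_min ltn_ord.
have ltS u : (size u <= size (drop i.+1 (x0 :: w)) -> size u < size (x0 :: w))%N.
  by rewrite size_drop => h; rewrite (leq_ltn_trans h) // -subSn // subSS leq_subr.
by congr (_ * _); apply: eq_conv => // u /ltS; apply: gg'.
Qed.

Lemma convDl f f' g1 g w :
  conv (fun u => f u + f' u) g1 g w = conv f g1 g w + conv f' g1 g w.
Proof.
elim: w f f' g1 => [|x w IH] f f' g1 /=; first by rewrite mulrDl.
by rewrite !IH mulrDr addrACA.
Qed.

Lemma convZl c f g1 g w : conv (fun u => c * f u) g1 g w = c * conv f g1 g w.
Proof.
elim: w f g1 => [|x w IH] f g1 /=; first by rewrite mulrA.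
by rewrite !IH mulrDr mulrCA.
Qed.

Lemma convDm f g1 g1' g w :
  conv f (fun u => g1 u + g1' u) g w = conv f g1 g w + conv f g1' g w.
Proof.
elim: w f g1 g1' => [|x w IH] f g1 g1' /=; first by rewrite mulrDr.
by rewrite !IH mulrDl addrACA.
Qed.

Lemma convZm c f g1 g w : conv f (fun u => c * g1 u) g w = c * conv f g1 g w.
Proof.
elim: w f g1 => [|x w IH] f g1 /=; first by rewrite mulrCA.
by rewrite !IH mulrDr !mulrA.
Qed.

(** Both sides sum over a subword T of a subword S of [w]: the part of S in a gap of
T splits that gap of T in [w] into the gaps of S. The distinguished first gap is
compatible with this, since the first gap of S lies in the first gap of T. *)
Lemma convA f g1 g k1 k w :
  conv (conv f g1 g) k1 k w = conv f (conv g1 k1 k) (conv g k k) w.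
Proof.
elim: w f g1 k1 => [|x w IH] f g1 k1 /=; first by rewrite mulrA.
rewrite convDl convZl convDm convZm !IH; ring.
Qed.

Definition conv_unit w : K := (nilp w)%:R.

Lemma conv0l f g1 g w : f =1 (fun=> 0) -> conv f g1 g w = 0.
Proof.
elim: w f g1 => [|x w IH] f g1 f0 /=; first by rewrite f0 mul0r.
by rewrite (IH (fun u => f (x :: u))) // mulr0 add0r IH.
Qed.

Lemma conv0m f g1 g w : g1 =1 (fun=> 0) -> conv f g1 g w = 0.
Proof.
elim: w f g1 => [|x w IH] f g1 f0 /=; first by rewrite f0 mulr0.
by rewrite f0 mul0r add0r IH.
Qed.

Lemma conv_unitl g1 g w : conv conv_unit g1 g w = g1 w.
Proof.
elim: w g1 => [|x w IH] g1 /=; first by rewrite mul1r.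
by rewrite conv0l // mulr0 add0r IH.
Qed.

Lemma conv_unitr f w : conv f conv_unit conv_unit w = f w.
Proof.
elim: w f => [|x w IH] f /=; first by rewrite mulr1.
by rewrite mul1r IH conv0m // addr0.
Qed.

End Convolution.

Lemma conv_map (T T' : Type) (K : comNzRingType) (a : T -> T')
    (f g1 g : seq T' -> K) w :
  conv f g1 g (map a w)
  = conv (fun u => f (map a u)) (fun u => g1 (map a u)) (fun u => g (map a u)) w.
Proof. by elim: w f g1 => [|x w IH] f g1 //=; rewrite !IH. Qed.

Lemma rmorph_conv (T : Type) (K L : comNzRingType) (F : {rmorphism K -> L})
    (f g1 g : seq T -> K) w :
  F (conv f g1 g w)
  = conv (fun u => F (f u)) (fun u => F (g1 u)) (fun u => F (g u)) w.
Proof.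
elim: w f g1 => [|x w IH] f g1 /=; first by rewrite rmorphM.
by rewrite rmorphD rmorphM !IH.
Qed.

Arguments conv : simpl never.

Section Flow.
Variable K : numFieldType.

Lemma deriv_inj (p q : {poly K}) : p^`() = q^`() -> p.[0] = q.[0] -> p = q.
Proof.
move=> dpq; rewrite !horner_coef0 => pq0; apply/polyP => -[//|i].
have := congr1 (fun r : {poly K} => r`_i) dpq; rewrite !coef_deriv => /eqP.
by rewrite -subr_eq0 -mulrnBl mulrn_eq0 subr_eq0 => /eqP.
Qed.

Definition integral (p : {poly K}) : {poly K} :=
  \poly_(i < (size p).+1) (p`_i.-1 / i%:R).

Lemma deriv_integral p : (integral p)^`() = p.
Proof.
apply/polyP => i; rewrite coef_deriv coef_poly /= ltnS.
case: ltnP => [_|/leq_sizeP ->] //; last by rewrite mul0rn.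
by rewrite -[LHS]mulr_natr divfK // pnatr_eq0.
Qed.

Lemma integral0 p : (integral p).[0] = 0.
Proof.
(* The constant coefficient is a quotient by 0, hence 0. *)
by rewrite horner_coef0 coef_poly /= invr0 mulr0.
Qed.

Variables (T : Type) (h : seq T -> K).

(** The generator of the flow: constant polynomials, cut to 0 on the empty word, so
that the subwords that contribute to a product are nonempty. *)
Definition cumulant_poly w : {poly K} := (if w is [::] then 0 else h w)%:P.

Lemma cumulant_poly_nil : cumulant_poly [::] = 0. Proof. exact: polyC0. Qed.

(** The solution of F' = h * F with F(0) the unit. The argument [d] only bounds the
depth of the recursion, see [flow_recE]. *)
Fixpoint flow_rec d w : {poly K} :=
  if w is [::] then 1 else
  if d is d'.+1 then integral (conv cumulant_poly (flow_rec d') (flow_rec d') w) else 0.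

Definition flow w := flow_rec (size w) w.

Lemma flow_recE d w : (size w <= d)%N -> flow_rec d w = flow w.
Proof.
rewrite /flow; have [k] := ubnP (size w); elim: k d w => // k IH [|d] [|x w] //.
rewrite /= !ltnS => lek led; congr integral.
have E u : (size u < size (x :: w) -> flow_rec d u = flow_rec (size w) u)%N.
  rewrite /= ltnS => leu; rewrite (IH d) ?(IH (size w)) //.
  - exact: leq_ltn_trans leu lek.
  - exact: leq_ltn_trans leu lek.
  - exact: leq_trans leu led.
by apply: eq_conv_lt => //; apply: cumulant_poly_nil.
Qed.

Lemma flow_nil : flow [::] = 1. Proof. by []. Qed.

Lemma deriv_flow w : (flow w)^`() = conv cumulant_poly flow flow w.
Proof.
case: w => [|x w]; first by rewrite /conv cumulant_poly_nil mul0r -[flow [::]]/(1%:P)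
  derivC.
rewrite deriv_integral; apply: eq_conv_lt cumulant_poly_nil _ _ => // u ltu;
  exact: flow_recE.
Qed.

Lemma flow_at0 w : (flow w).[0] = conv_unit K w.
Proof. by case: w => [|x w]; [rewrite hornerC | rewrite integral0]. Qed.

Lemma deriv_convC (f : seq T -> {poly K}) (g1 g : seq T -> K) w :
  (conv f (fun u => (g1 u)%:P) (fun u => (g u)%:P) w)^`()
  = conv (fun u => (f u)^`()) (fun u => (g1 u)%:P) (fun u => (g u)%:P) w.
Proof.
elim: w f g1 => [|x w IH] f g1 /=; first by rewrite derivM derivC mulr0 addr0.
by rewrite derivD derivM derivC mul0r add0r !IH.
Qed.

(** As functions of X, both sides have the same value at 0 and the same derivative:
F'(X + c) = h * F(X + c) = h * (F(X) * F(c)) = (h * F(X)) * F(c), by induction on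
the length and by associativity. *)
Lemma flow_shift c w :
  flow w \Po ('X + c%:P)
  = conv flow (fun u => (flow u).[c]%:P) (fun u => (flow u).[c]%:P) w.
Proof.
have [k] := ubnP (size w); elim: k w => // k IH w lek.
apply: deriv_inj.
  rewrite deriv_comp derivD derivX derivC addr0 mulr1 deriv_flow.
  rewrite deriv_convC.
  rewrite (rmorph_conv (@comp_poly _ ('X + c%:P))).
  pose fc u := (flow u).[c]%:P.
  transitivity (conv cumulant_poly (conv flow fc fc) (conv flow fc fc) w).
    rewrite -[LHS]/(conv _ _ _ w).
    transitivity (conv cumulant_poly (fun u => comp_poly ('X + c%:P) (flow u))
       (fun u => comp_poly ('X + c%:P) (flow u)) w).
      by apply: eq_conv => // u _; rewrite /= comp_polyC.
    by apply: eq_conv_lt cumulant_poly_nil _ _ => // u ltu; apply: IH;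
      apply: leq_trans ltu _.
  rewrite -convA; apply: eq_conv => // u _; exact/esym/deriv_flow.
rewrite horner_comp !hornerE.
rewrite -[RHS]/(horner_eval 0 (conv _ _ _ _)) rmorph_conv /=.
rewrite -[LHS](@conv_unitl T K (fun u => (flow u).[c]) (fun u => (flow u).[c])).
by apply: eq_conv => u _; rewrite /= /horner_eval ?flow_at0 ?hornerC.
Qed.

Lemma flow_atS c w : (flow w).[1 + c] =
  conv (fun u => (flow u).[1]) (fun u => (flow u).[c]) (fun u => (flow u).[c]) w.
Proof.
have := congr1 (horner_eval 1) (flow_shift c w).
rewrite rmorph_conv /horner_eval horner_comp !hornerE => ->.
by apply: eq_conv => u _; rewrite /= /horner_eval ?hornerC.
Qed.

(** The derivative of the flow at 0 is the product of the generator with the unit. *)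
Lemma flow_coef1 x w : (flow (x :: w))`_1 = h (x :: w).
Proof.
have -> : (flow (x :: w))`_1 = (flow (x :: w))^`().[0].
  by rewrite horner_coef0 coef_deriv mulr1n.
rewrite deriv_flow -[LHS]/(horner_eval 0 _) rmorph_conv.
transitivity (conv (fun u => horner_eval 0 (cumulant_poly u))
  (conv_unit K) (conv_unit K) (x :: w)).
  by apply: eq_conv => u _ //=; rewrite /horner_eval flow_at0.
by rewrite conv_unitr /horner_eval hornerC.
Qed.

End Flow.

(** Transports the flow between words over an algebra and words of indices. *)
Lemma flow_map (K : numFieldType) (T T' : Type) (a : T -> T') (h : seq T' -> K) w :
  flow h (map a w) = flow (fun u => h (map a u)) w.
Proof.
have [k] := ubnP (size w); elim: k w => // k IH w lek.
apply: deriv_inj; last by rewrite !flow_at0 /conv_unit /nilp size_map.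
rewrite !deriv_flow conv_map.
transitivity (conv (cumulant_poly (fun u => h (map a u))) (fun u => flow h (map a u))
   (fun u => flow h (map a u)) w).
  by apply: eq_conv => // -[].
by apply: eq_conv_lt (cumulant_poly_nil _) _ _ => // u ltu; apply: IH;
  apply: leq_trans ltu _.
Qed.

(** * Strict labellings of posets and trees *)

Local Open Scope nat_scope.

Section StrictMaps.

Definition strict_map (T : finType) (e : rel T) N (f : {ffun T -> 'I_N}) :=
  [forall v, forall w, e v w ==> (f v < f w)].

Definition strict_maps (T : finType) (e : rel T) N :=
  #|[set f : {ffun T -> 'I_N} | strict_map e f]|.

Lemma strict_mapP (T : finType) (e : rel T) N (f : {ffun T -> 'I_N}) :
  reflect (forall v w, e v w -> f v < f w) (strict_map e f).
Proof.
apply: (iffP 'forall_forallP) => H v w; last exact/implyP/H.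
by move/implyP: (H v w).
Qed.

Lemma strict_maps_bij (T T' : finType) (e : rel T) (e' : rel T') (g : T -> T') N :
    bijective g -> (forall x y, e x y = e' (g x) (g y)) ->
  strict_maps e N = strict_maps e' N.
Proof.
case=> g' gK g'K ee'; rewrite /strict_maps.
pose F (f : {ffun T' -> 'I_N}) := [ffun x => f (g x)].
have Finj : injective F.
  move=> f1 f2 /ffunP E; apply/ffunP => y.
  by have := E (g' y); rewrite !ffunE g'K.
rewrite -(card_imset _ Finj); congr #|pred_of_set _|; apply/setP => f.
apply/idP/imsetP => [|[f']]; rewrite !inE => /strict_mapP fS.
  exists [ffun y => f (g' y)]; last by apply/ffunP => x; rewrite !ffunE gK.
  rewrite inE; apply/strict_mapP => v w; rewrite !ffunE => evw; apply: fS.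
  by rewrite ee' !g'K.
move=> ->; apply/strict_mapP => v w; rewrite !ffunE => evw.
by apply: fS; rewrite -ee'.
Qed.

Definition rel_sum (T1 T2 : Type) (e1 : rel T1) (e2 : rel T2) : rel (T1 + T2) :=
  fun x y => match x, y with
             | inl x, inl y => e1 x y
             | inr x, inr y => e2 x y
             | _, _ => false
             end.

Lemma strict_maps_sum (T1 T2 : finType) (e1 : rel T1) (e2 : rel T2) N :
  strict_maps (rel_sum e1 e2) N = strict_maps e1 N * strict_maps e2 N.
Proof.
rewrite /strict_maps -cardsX.
pose F (p : {ffun T1 -> 'I_N} * {ffun T2 -> 'I_N}) : {ffun T1 + T2 -> 'I_N} :=
  [ffun x => match x with inl x => p.1 x | inr x => p.2 x end].
have Finj : injective F.
  move=> [f1 f2] [g1 g2] /ffunP E; congr pair; apply/ffunP => x.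
    by have := E (inl x); rewrite !ffunE.
  by have := E (inr x); rewrite !ffunE.
rewrite -(card_imset _ Finj); congr #|pred_of_set _|; apply/setP => f.
apply/idP/imsetP => [|[[f1 f2]]]; rewrite !inE /=.
  move=> /strict_mapP fS.
  exists ([ffun x => f (inl x)], [ffun x => f (inr x)]).
    rewrite !inE; apply/andP; split; apply/strict_mapP => v w ?;
      by rewrite !ffunE; apply: fS.
  by apply/ffunP => -[] x; rewrite !ffunE.
case/andP=> /strict_mapP f1S /strict_mapP f2S ->.
by apply/strict_mapP => -[] v [] w //=; rewrite !ffunE /=; [apply: f1S | apply: f2S].
Qed.

Definition rel_bot (T : Type) (e : rel T) : rel (option T) :=
  fun x y => match x, y with
             | Some x, Some y => e x y
             | None, Some _ => true
             | _, None => false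
             end.

Lemma lift0_ffun (T : finType) N (f : {ffun T -> 'I_N.+1}) :
  (forall x, f x != ord0) -> exists g : {ffun T -> 'I_N}, forall x, f x = lift ord0 (g x).
Proof.
move=> f0; have f0' x : ord0 != f x by rewrite eq_sym.
exists [ffun x => s2val (unlift_some (f0' x))] => x.
by rewrite ffunE; case: (unlift_some _).
Qed.

(** The value 0 is either taken at the bottom element only, or not at all; in both
cases the remaining values can be lowered by 1. *)
Lemma strict_maps_bot (T : finType) (e : rel T) N :
  strict_maps (rel_bot e) N.+1 = strict_maps e N + strict_maps (rel_bot e) N.
Proof.
rewrite /strict_maps.
set A := [set f : {ffun option T -> 'I_N.+1} | _].
rewrite -(cardsID [set f : {ffun option T -> 'I_N.+1} | f None == ord0] A).
pose F (f : {ffun T -> 'I_N}) : {ffun option T -> 'I_N.+1} :=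
  [ffun x => if x is Some y then lift ord0 (f y) else ord0].
have Finj : injective F.
  move=> f g /ffunP E; apply/ffunP => x; apply: (@lift_inj _ ord0).
  by have := E (Some x); rewrite !ffunE.
pose G (f : {ffun option T -> 'I_N}) : {ffun option T -> 'I_N.+1} :=
  [ffun x => lift ord0 (f x)].
have Ginj : injective G.
  move=> f g /ffunP E; apply/ffunP => x; apply: (@lift_inj _ ord0).
  by have := E x; rewrite !ffunE.
rewrite -(card_imset _ Finj) -(card_imset _ Ginj).
congr addn; congr #|pred_of_set _|; apply/setP => f.
  rewrite !inE; apply/andP/imsetP => [[/strict_mapP fS /eqP f0]|[g]].
    have [|g Eg] := @lift0_ffun T N [ffun x => f (Some x)].
      move=> x; rewrite ffunE; apply: contraTneq (fS None (Some x) isT) => ->.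
      by rewrite f0.
    exists g; last first.
      by apply/ffunP => -[x|]; rewrite ffunE ?f0 // -Eg ffunE.
    rewrite inE; apply/strict_mapP => v w evw.
    by have := fS (Some v) (Some w) evw; have := Eg v; have := Eg w;
       rewrite !ffunE => -> ->.
  rewrite inE => /strict_mapP gS ->; split; last by rewrite ffunE.
  apply/strict_mapP => -[v|] [w|] //=; rewrite !ffunE //.
  exact: gS.
rewrite !inE; apply/andP/imsetP => [[f0 /strict_mapP fS]|[g]].
  have [x|g Eg] := @lift0_ffun _ N f.
    case: x => [x|//]; apply: contraTneq (fS None (Some x) isT) => ->.
    by rewrite ltn0.
  exists g; last by apply/ffunP => x; rewrite Eg ffunE.
  rewrite inE; apply/strict_mapP => v w /fS.
  by rewrite !Eg.
rewrite inE => /strict_mapP gS ->; split; first by rewrite ffunE.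
by apply/strict_mapP => v w /gS; rewrite !ffunE.
Qed.

Lemma strict_maps_void (T : finType) (e : rel T) : 0 < #|T| -> strict_maps e 0 = 0.
Proof.
case/card_gt0P=> x _; apply: eq_card0 => f; case: (f x) => //.
Qed.

Lemma sorted_enum_ord n (V : {set 'I_n}) :
  sorted (fun i j : 'I_n => i < j) (enum V).
Proof.
rewrite /enum_mem; apply: sorted_filter; first by move=> y x z; apply: ltn_trans.
by rewrite -enumT -[sorted _ _](sorted_map (f := val) (e' :=
  ltn)) val_enum_ord iota_ltn_sorted.
Qed.

Lemma enum_val_ltn n (V : {set 'I_n}) (i j : 'I_#|V|) :
  (enum_val i < enum_val j) = (i < j).
Proof.
have mono (k l : 'I_#|V|) : k < l -> enum_val k < enum_val l.
  move=> kl; rewrite /enum_val.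
  rewrite (set_nth_default (enum_default l)); last by rewrite -cardE.
  have ltt : transitive (fun i j : 'I_n => i < j) by move=> y x z; apply: ltn_trans.
  apply: (sorted_ltn_nth ltt _ (sorted_enum_ord V)) => //.
  - by rewrite inE -cardE.
  - by rewrite inE -cardE.
apply/idP/idP; last exact: mono.
apply: contraTT; rewrite -!leqNgt leq_eqVlt => /predU1P[E|/mono/ltnW //].
by rewrite (val_inj E).
Qed.

Definition surjective_map (T : finType) N (f : {ffun T -> 'I_N}) :=
  [forall j, exists v, f v == j].

Definition strict_surjections (T : finType) (e : rel T) N :=
  #|[set f : {ffun T -> 'I_N} | surjective_map f && strict_map e f]|.

(** A map with image [J] is a surjection to {0, ..., #|J| - 1} followed by the
increasing enumeration of [J]. *)
Lemma strict_maps_image (T : finType) (e : rel T) N (J : {set 'I_N}) :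
  #|[set f : {ffun T -> 'I_N} | strict_map e f && (f @: setT == J)]|
  = strict_surjections e #|J|.
Proof.
pose F (f : {ffun T -> 'I_#|J|}) : {ffun T -> 'I_N} := [ffun x => enum_val (f x)].
have Finj : injective F.
  move=> f g /ffunP E; apply/ffunP => x; apply: enum_val_inj.
  by have := E x; rewrite !ffunE.
rewrite /strict_surjections -(card_imset _ Finj).
congr #|pred_of_set _|; apply/setP => f; rewrite inE.
apply/andP/imsetP => [[/strict_mapP fS /eqP fJ]|[g]].
  have fxJ x : f x \in J by rewrite -fJ imset_f.
  have Ef x : f x = enum_val (enum_rank_in (fxJ x) (f x)) by rewrite enum_rankK_in.
  exists [ffun x => enum_rank_in (fxJ x) (f x)]; last first.
    by apply/ffunP => x; rewrite !ffunE.
  rewrite inE; apply/andP; split.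
    apply/forallP => j.
    have : enum_val j \in f @: setT by rewrite fJ enum_valP.
    case/imsetP => x _ Ex.
    by apply/existsP; exists x; rewrite ffunE; apply/eqP/enum_val_inj; rewrite -Ef Ex.
  by apply/strict_mapP => v w /fS; rewrite !ffunE -enum_val_ltn -!Ef.
rewrite inE => /andP[/forallP gJ /strict_mapP gS] ->; split.
  by apply/strict_mapP => v w /gS; rewrite !ffunE enum_val_ltn.
apply/eqP/setP => j; apply/imsetP/idP => [[x _ ->]|jJ]; first by rewrite ffunE enum_valP.
have /existsP[x /eqP Ex] := gJ (enum_rank_in jJ j).
by exists x; rewrite // ffunE Ex enum_rankK_in.
Qed.

(** Strict maps are sorted by their images, subsets of {0, ..., N - 1}. *)
Lemma strict_mapsE (T : finType) (e : rel T) N :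
  strict_maps e N = \sum_(j < N.+1) 'C(N, j) * strict_surjections e j.
Proof.
rewrite /strict_maps -sum1_card.
rewrite (partition_big (fun f : {ffun T -> 'I_N} => f @: setT) xpredT) //=.
transitivity (\sum_(J : {set 'I_N}) strict_surjections e #|J|).
  apply: eq_bigr => J _; rewrite -strict_maps_image -sum1_card.
  by apply: eq_bigl => f; rewrite !inE.
have card_lt (J : {set 'I_N}) : #|J| < N.+1.
  by rewrite ltnS -[leqRHS]card_ord max_card.
rewrite (partition_big (fun J : {set 'I_N} => Ordinal (card_lt J)) xpredT) //=.
apply: eq_bigr => j _.
rewrite (eq_bigr (fun=> strict_surjections e j)); last by move=> J /eqP <-.
rewrite sum_nat_cond_const; congr (_ * _).
have := card_draws 'I_N j; rewrite card_ord => <-; apply: eq_card => J.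
by rewrite !inE -val_eqE.
Qed.

Lemma strict_surjections_big (T : finType) (e : rel T) N :
  #|T| < N -> strict_surjections e N = 0.
Proof.
move=> ltN; apply: eq_card0 => f; rewrite !inE; apply/negP => /andP[/forallP fS _].
have : #|f @: [set: T]| <= #|T| by rewrite (leq_trans (leq_imset_card _ _)) // cardsT.
suff -> : f @: [set: T] = setT by rewrite cardsT card_ord leqNgt ltN.
by apply/setP => j; have /existsP[x /eqP <-] := fS j; rewrite inE imset_f.
Qed.

Lemma strict_surjections0 (T : finType) (e : rel T) :
  0 < #|T| -> strict_surjections e 0 = 0.
Proof. by case/card_gt0P=> x _; apply: eq_card0 => f; case: (f x). Qed.

End StrictMaps.

Section TreeVertices.

(** [addresses_below] with the children numbered from [i], which allows inductions on
the list of children. *)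
Fixpoint forest_addresses i (L : seq (seq (seq nat))) :=
  if L is l :: L' then map (cons i) l ++ forest_addresses i.+1 L' else [::].

Lemma addresses_belowE L : addresses_below L = forest_addresses 0 L.
Proof.
rewrite /addresses_below.
suff H i : [seq j :: p | j <- iota i (size L), p <- nth [::] L (j - i)]
  = forest_addresses i L.
  by rewrite -H; congr flatten; apply: eq_map => j; rewrite subn0.
elim: L i => //= l L IH i; rewrite subnn -IH; congr (_ ++ flatten _).
apply/eq_in_map => j; rewrite mem_iota => /andP[]; rewrite -subn_gt0 subnS.
by case: (j - i).
Qed.

Lemma mem_forest_addresses_nil i L : [::] \in forest_addresses i L = false.
Proof.
elim: L i => //= l L IH i; rewrite mem_cat IH orbF.
by apply/negP => /mapP[].
Qed.

Lemma mem_forest_addresses_cons i L j p :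
  (j :: p \in forest_addresses i L) = (i <= j) && (p \in nth [::] L (j - i)).
Proof.
elim: L i => [|l L IH] i /=; first by rewrite nth_nil andbF.
rewrite mem_cat IH; have [<-|neq] := eqVneq i j.
  by rewrite ltnn orbF leqnn subnn mem_map // => x y [].
have -> /= : (j :: p \in [seq i :: q | q <- l]) = false.
  by apply/negP => /mapP[q _ [E _]]; rewrite E eqxx in neq.
rewrite (leq_eqVlt i j) (negPf neq) /= subnS; case: ltnP => //.
by rewrite -subn_gt0; case: (j - i).
Qed.

Lemma below_cons i j p q : below (i :: p) (j :: q) = (i == j) && below p q.
Proof. by rewrite /below eqseq_cons /=; case: eqVneq => //= <-. Qed.

Definition below_in (X : seq (seq nat)) : rel (seq_sub X) :=
  fun v w => below (val v) (val w).

(** The counts for lists of addresses are reduced to those for sums and for posets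
with an added bottom through a labelling [g] by addresses. *)
Lemma strict_maps_seq_sub (T : finType) (e : rel T) X (g : T -> seq nat) N :
    injective g -> (forall p, reflect (exists x, g x = p) (p \in X)) ->
    (forall x y, e x y = below (g x) (g y)) ->
  strict_maps e N = strict_maps (@below_in X) N.
Proof.
move=> ginj gX eg; have gXx x : g x \in X by apply/gX; exists x.
apply: (@strict_maps_bij _ _ _ _ (fun x => SeqSub (gXx x))) => //.
have exg (y : seq_sub X) : exists x, g x == val y.
  by have /gX[x <-] := valP y; exists x.
exists (fun y => xchoose (exg y)) => [x|y]; last exact/val_inj/eqP/(xchooseP (exg y)).
exact/ginj/eqP/(xchooseP (exg _)).
Qed.

Lemma strict_maps_below_nil L N :
  strict_maps (@below_in ([::] :: forest_addresses 0 L)) N.+1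
  = strict_maps (@below_in (forest_addresses 0 L)) N
    + strict_maps (@below_in ([::] :: forest_addresses 0 L)) N.
Proof.
have E M : strict_maps (rel_bot (@below_in (forest_addresses 0 L))) M
         = strict_maps (@below_in ([::] :: forest_addresses 0 L)) M.
  apply: (@strict_maps_seq_sub _ _ _
           (fun x => if x is Some p then val p else [::])).
  - move=> [p|] [q|] //; first by move/val_inj->.
    + by move=> pE; have := valP p; rewrite pE mem_forest_addresses_nil.
    + by move=> pE; have := valP q; rewrite -pE mem_forest_addresses_nil.
  - move=> p; rewrite inE; apply: (iffP orP) => [[/eqP->|pL]|[[q|] <-]].
    + by exists None.
    + by exists (Some (SeqSub pL)).
    + by right; apply: valP.
    + by left.
  - move=> [[[|i p] pL]|] [[[|j q] qL]|] //=.
    by move: qL; rewrite mem_forest_addresses_nil.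
by rewrite -!E strict_maps_bot.
Qed.

Lemma strict_maps_below_cat i l L N :
  strict_maps (@below_in (forest_addresses i (l :: L))) N
  = strict_maps (@below_in l) N * strict_maps (@below_in (forest_addresses i.+1 L)) N.
Proof.
have headL (q : seq_sub (forest_addresses i.+1 L)) p : val q <> i :: p.
  by move=> E; have := valP q; rewrite E mem_forest_addresses_cons ltnn.
rewrite -strict_maps_sum; apply/esym.
apply: (@strict_maps_seq_sub _ _ _ (fun x : seq_sub l + seq_sub (forest_addresses
  i.+1 L) =>
          match x with inl p => i :: val p | inr q => val q end)).
- move=> [p|p] [q|q] //.
  + by case=> /val_inj->.
  + by move/esym/headL.
  + by move/headL.
  + by move/val_inj->.
- move=> p; rewrite /= mem_cat.
  apply: (iffP orP) => [[/mapP[q ql ->]|pL]|[[q|q] <-]].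
  + by exists (inl (SeqSub ql)).
  + by exists (inr (SeqSub pL)).
  + by left; apply/map_f/valP.
  + by right; apply: valP.
- move=> [p|p] [q|q] //=; rewrite /below_in.
  + by rewrite below_cons eqxx.
  + case: q => -[|j r]; rewrite /= ?mem_forest_addresses_nil //
    mem_forest_addresses_cons below_cons.
    by case: eqVneq => // <-; rewrite ltnn.
  + case: p => -[|j r]; rewrite /= ?mem_forest_addresses_nil //
    mem_forest_addresses_cons below_cons.
    by case: eqVneq => // ->; rewrite ltnn.
Qed.

Lemma strict_maps_below_addr i Ls N :
  strict_maps (@below_in (forest_addresses i Ls)) N
  = \prod_(l <- Ls) strict_maps (@below_in l) N.
Proof.
elim: Ls i => [|l L IH] i; last by rewrite strict_maps_below_cat big_cons IH.
have no (x : seq_sub (forest_addresses i [::])) : False by have := valP x.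
rewrite big_nil /strict_maps (@eq_card1 _ [ffun x => False_rect _ (no x)]) // => f.
rewrite !inE; apply/strict_mapP/eqP => [_|_ v]; last by case: (no v).
by apply/ffunP => x; case: (no x).
Qed.

(** The strict order polynomial of the tree, at the natural number [N]. *)
Definition order_count (s : tree) N := strict_maps (@below_in (vertices s)) N.

(** The root is a bottom element, and the subtrees of its children are unrelated. *)
Lemma order_countS ss N :
  order_count (Node ss) N.+1
  = order_count (Node ss) N + \prod_(s <- ss) order_count s N.
Proof.
rewrite /order_count /= addresses_belowE strict_maps_below_nil addnC.
by rewrite strict_maps_below_addr big_map.
Qed.

Lemma uniq_forest_addresses i L : all uniq L -> uniq (forest_addresses i L).
Proof.
elim: L i => //= l L IH i /andP[ul /IH uL].
rewrite cat_uniq uL andbT map_inj_uniq ?ul => [|p q []//].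
apply/hasPn => -[|j p]; first by rewrite mem_forest_addresses_nil.
rewrite mem_forest_addresses_cons => /andP[lt _]; apply/negP => /mapP[q _ [E _]].
by rewrite E ltnn in lt.
Qed.

Lemma uniq_vertices s : uniq (vertices s).
Proof.
elim/tree_ind': s => ss IH /=; rewrite addresses_belowE mem_forest_addresses_nil
  uniq_forest_addresses //.
apply/(all_nthP [::]) => i; rewrite size_map => lti.
by rewrite (nth_map (Node [::])) //; apply: IH.
Qed.

Lemma card_vertices s : #|{: seq_sub (vertices s)}| = tree_size s.
Proof. by rewrite card_seq_sub ?uniq_vertices. Qed.

Lemma vertices_nonempty s : 0 < #|{: seq_sub (vertices s)}|.
Proof.
by apply/card_gt0P; case: s => ss; exists (SeqSub (mem_head [::] _)).
Qed.

Lemma order_count0 s : order_count s 0 = 0.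
Proof. exact/strict_maps_void/vertices_nonempty. Qed.

Lemma murua_kE k s : murua_k k s = strict_surjections (@below_in (vertices s)) k.
Proof. by apply: eq_card => f; rewrite !inE. Qed.

Lemma order_countE s N :
  order_count s N = \sum_(1 <= k < (tree_size s).+1) 'C(N, k) * murua_k k s.
Proof.
have S0 := strict_surjections0 (@below_in (vertices s)) (vertices_nonempty s).
transitivity (\sum_(k < N.+1 + (tree_size s).+1) 'C(N, k) * murua_k k s).
  rewrite /order_count strict_mapsE big_split_ord /= [X in _ + X]big1 ?addn0.
    by apply: eq_bigr => k _; rewrite murua_kE.
  by move=> k _; rewrite bin_small // leq_addr.
rewrite addnC big_split_ord /= [X in _ + X]big1 ?addn0; last first.
  move=> k _; rewrite murua_kE strict_surjections_big ?muln0 //.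
  by rewrite card_vertices ltnS leq_addr.
rewrite -(big_mkord xpredT (fun k => 'C(N, k) * murua_k k s)).
by rewrite big_ltn // murua_kE S0 muln0.
Qed.
End TreeVertices.

(** * Sums over Schroder trees *)

Local Open Scope ring_scope.

Section BinomialPoly.
Variable K : numFieldType.

(** The binomial coefficient X (X - 1) ... (X - j + 1) / j! as a polynomial in X. *)
Fixpoint bin_poly j : {poly K} :=
  if j is j'.+1 then j%:R^-1 *: (bin_poly j' * ('X - j'%:R%:P)) else 1.

Lemma horner_bin_poly j N : (bin_poly j).[N%:R] = 'C(N, j)%:R.
Proof.
elim: j => [|j IH] /=; first by rewrite hornerE bin0.
rewrite hornerZ hornerM IH hornerXsubC.
apply: (@mulfI _ j.+1%:R); rewrite ?pnatr_eq0 // mulVKf ?pnatr_eq0 //.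
rewrite -natrM mul_bin_left natrM mulrC.
have [ltNj|leqjN] := ltnP N j; first by rewrite bin_small // !mulr0.
by rewrite natrB.
Qed.

Lemma bin_poly_coef0 j : (bin_poly j)`_0 = (j == 0%N)%:R.
Proof. by rewrite -horner_coef0 (horner_bin_poly j 0) bin0n. Qed.

(** The origin of the signs and denominators in the Murua coefficient. *)
Lemma bin_poly_coef1 j : (0 < j)%N -> (bin_poly j)`_1 = (-1) ^+ j.+1 / j%:R.
Proof.
case: j => // j _; elim: j => [|j IH].
  by rewrite /= subr0 mul1r invr1 scale1r coefX sqrrN !expr1n mulr1.
rewrite [bin_poly j.+2]/= -/(bin_poly j.+1) coefZ mulrBr coefB coefMX coefMC.
rewrite bin_poly_coef0 IH sub0r mulfVK ?pnatr_eq0 // mulrC.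
by rewrite [in RHS]exprS mulN1r.
Qed.

Lemma poly_eq_nat (p q : {poly K}) : (forall N : nat, p.[N%:R] = q.[N%:R]) -> p = q.
Proof.
move=> pq; apply/eqP; rewrite -subr_eq0; apply/negP => /negP nz.
have := max_poly_roots nz (rs := [seq i%:R | i <- iota 0 (size (p - q))]).
rewrite size_map size_iota ltnn map_inj_uniq ?iota_uniq => [H|i j /eqP]; last first.
  by rewrite eqr_nat => /eqP.
suff : false by []; apply: H => //; apply/allP => _ /mapP[i _ ->].
by rewrite /root !hornerE pq subrr.
Qed.

End BinomialPoly.

Section Sectors.
Local Open Scope nat_scope.

Definition adjacent_lcas (X : seq (seq nat)) :=
  if X is u :: X' then pairmap lca u X' else [::].

Definition sectors t := adjacent_lcas (leaves t).

Lemma size_adjacent_lcas X : size (adjacent_lcas X) = (size X).-1.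
Proof. by case: X => //= u X; rewrite size_pairmap. Qed.

Lemma adjacent_lcas_map i X : adjacent_lcas (map (cons i) X)
  = map (cons i) (adjacent_lcas X).
Proof.
case: X => //= u X; elim: X u => //= v X IH u.
by rewrite eqxx IH.
Qed.

Lemma adjacent_lca_prefix X p : p \in adjacent_lcas X -> exists2 u, u \in X & prefix p u.
Proof.
have prefix_lca u v : prefix (lca u v) u.
  by elim: u v => [|x u IH] [|y v] //=; case: eqVneq => //= _; rewrite eqxx IH.
case: X => //= u X; elim: X u => //= v X IH u.
rewrite inE => /predU1P[->|/IH[w wX pw]].
  by exists u; rewrite ?mem_head // prefix_lca.
by exists w; rewrite // inE wX orbT.
Qed.

Lemma leaves_neq0 t : leaves t != [::].
Proof. by rewrite -size_eq0 -lt0n size_leaves_gt0. Qed.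

Lemma adjacent_lcas_tree i s : adjacent_lcas (forest_addresses i [:: leaves s])
  = map (cons i) (sectors s).
Proof. by rewrite /= cats0 adjacent_lcas_map. Qed.

Lemma adjacent_lcas_forest i s s' ss :
  adjacent_lcas (forest_addresses i (map leaves [:: s, s' & ss]))
  = map (cons i) (sectors s) ++ [::] :: adjacent_lcas (forest_addresses i.+1 (map
    leaves (s' :: ss))).
Proof.
rewrite /sectors -adjacent_lcas_map /=.
case: (leaves s) (leaves_neq0 s) => //= u X _.
case: (leaves s') (leaves_neq0 s') => //= v Y _.
rewrite pairmap_cat /=; congr (_ ++ _ :: _).
by rewrite last_map /= eqn_leq ltnn andbF.
Qed.

Lemma adjacent_lcas_head i p L : i :: p \notin adjacent_lcas (forest_addresses i.+1 L).
Proof.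
apply/negP => /adjacent_lca_prefix[[|j u]]; first by rewrite mem_forest_addresses_nil.
by rewrite mem_forest_addresses_cons /= => /andP[lt _]; case: eqVneq lt => // ->;
  rewrite ltnn.
Qed.

Lemma leaves_Node ss : ss != [::] -> leaves (Node ss)
  = forest_addresses 0 (map leaves ss).
Proof. by case: ss => // s ss _; rewrite -addresses_belowE. Qed.

Lemma size_forest_addresses i L : size (forest_addresses i L) = sumn (map size L).
Proof. by elim: L i => //= l L IH i; rewrite size_cat size_map IH. Qed.

Lemma internal_vertices_leaf : internal_vertices (Node [::]) = [::].
Proof. by []. Qed.

Lemma internal_vertices_Node ss : ss != [::] ->
  internal_vertices (Node ss) = [::] :: forest_addresses 0 (map internal_vertices ss).
Proof.
move=> ss0; rewrite /internal_vertices leaves_Node //= addresses_belowE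
  mem_forest_addresses_nil /=.
congr cons; elim: ss 0 {ss0} => //= s ss IH i.
rewrite filter_cat filter_map -IH; congr (map _ _ ++ _).
  apply: eq_in_filter => p _ /=; rewrite mem_cat mem_forest_addresses_cons ltnn orbF.
  by rewrite mem_map // => x y [].
apply: eq_in_filter => -[|j p]; first by rewrite mem_forest_addresses_nil.
rewrite mem_forest_addresses_cons => /andP[lt _]; rewrite mem_cat.
have /negbTE -> // : j :: p \notin [seq i :: q | q <- leaves s].
by apply/negP => /mapP[q _ [E _]]; rewrite E ltnn in lt.
Qed.

Lemma mask_pred1_notin (T : Type) (g : seq (seq nat)) v (w : seq T) :
  v \notin g -> mask (map (pred1 v) g) w = [::].
Proof.
elim: g w => [|p g IH] [|x w] //=; rewrite inE negb_or => /andP[ne /IH ->].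
by rewrite eq_sym (negPf ne).
Qed.

Lemma mask_pred1_cons (T : Type) i (g : seq (seq nat)) v (w : seq T) :
  mask (map (pred1 (i :: v)) (map (cons i) g)) w = mask (map (pred1 v) g) w.
Proof. by congr mask; rewrite -map_comp; apply: eq_map => p /=;
  rewrite eqseq_cons eqxx. Qed.

End Sectors.

Section TreeSums.
Variables (K : comNzRingType) (T : Type).
Implicit Types (f : seq T -> K) (G : tree -> seq T -> K) (w : seq T).

(** The value of a forest s_0, ..., s_k on a word w_0 x_1 w_1 ... x_k w_k, where the
length of w_i is one less than the number of leaves of s_i:
f(x_1 ... x_k) G(s_0, w_0) ... G(s_k, w_k). On a word that is too short the value
is the default 0. *)
Fixpoint forest_val G f ss w : K :=
  if ss is s :: ss' then
    if ss' is [::] then f [::] * G s w else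
    let k := (size (leaves s)).-1 in
    if drop k w is x :: w' then
      G s (take k w) * forest_val G (fun u => f (x :: u)) ss' w'
    else 0
  else 0.

Arguments forest_val : simpl never.

Lemma forest_val1 G f s w : forest_val G f [:: s] w = f [::] * G s w.
Proof. by []. Qed.

Lemma forest_val_cons G f s s' ss w :
  forest_val G f [:: s, s' & ss] w =
  if drop (size (leaves s)).-1 w is x :: w' then
    G s (take (size (leaves s)).-1 w)
    * forest_val G (fun u => f (x :: u)) (s' :: ss) w'
  else 0.
Proof. by []. Qed.

(** The multiplicative extension of [f] over the partition of the letters of [w] by
the sectors of [t]. *)
Definition tree_val f t w : K :=
  \prod_(v <- internal_vertices t) f (mask (map (pred1 v) (sectors t)) w).

(** A sector between two consecutive trees of the forest is labelled by the
root, and a sector inside the tree numbered j by an address that starts with j: the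
root block is the word x_1 ... x_k of [forest_val] and the other blocks are those
of the trees. *)
Lemma forest_val_prod m f i ss w : ss != [::] ->
    size w = size (adjacent_lcas (forest_addresses i (map leaves ss))) ->
  f (mask (map (pred1 [::]) (adjacent_lcas (forest_addresses i (map leaves ss)))) w) *
    \prod_(v <- forest_addresses i (map internal_vertices ss))
       m (mask (map (pred1 v) (adjacent_lcas (forest_addresses i (map leaves ss)))) w)
  = forest_val (tree_val m) f ss w.
Proof.
have nilN j (g : seq (seq nat)) : [::] \notin map (cons j) g.
  by apply/negP => /mapP[].
elim: ss i f w => // s [|s' ss] IH i f w _.
  rewrite adjacent_lcas_tree => _; rewrite mask_pred1_notin //= cats0 big_map forest_val1.
  by congr (_ * _); apply: eq_bigr => v _; rewrite mask_pred1_cons.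
rewrite forest_val_cons adjacent_lcas_forest -[forest_addresses i _]/(map (cons i)
  (internal_vertices s)
  ++ forest_addresses i.+1 (map internal_vertices (s' :: ss))) big_cat big_map.
set B := forest_addresses i.+1 (map leaves (s' :: ss)); set C := forest_addresses i.+1 _.
have szs : size (sectors s) = (size (leaves s)).-1 by exact: size_adjacent_lcas.
rewrite size_cat size_map /= szs => szw.
have ltk : ((size (leaves s)).-1 < size w)%N by rewrite szw addnS ltnS leq_addr.
case: w szw ltk => // x0 w szw ltk.
set k := (size (leaves s)).-1 in szw ltk *.
have Ew := cat_take_drop k (x0 :: w).
rewrite (drop_nth x0 ltk) in Ew; rewrite (drop_nth x0 ltk).
set x := nth _ _ _ in Ew *; set w1 := take k _ in Ew *; set w2 := drop _ _ in Ew *.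
have sz1 : size w1 = size (map (cons i) (sectors s)).
  by rewrite size_takel ?(ltnW ltk) // size_map szs.
have sz2 : size w2 = size (adjacent_lcas B).
  by rewrite size_drop szw addnS subSS addKn.
have maskE v : mask (map (pred1 v) (map (cons i) (sectors s) ++ [::] :: adjacent_lcas
  B)) (x0 :: w)
    = mask (map (pred1 v) (map (cons i) (sectors s))) w1
      ++ nseq (v == [::]) x ++ mask (map (pred1 v) (adjacent_lcas B)) w2.
  rewrite -Ew map_cat mask_cat ?size_map //=; last by rewrite sz1 size_map.
  by case: v.
rewrite maskE mask_pred1_notin //= mulrCA; congr (_ * _).
  apply: eq_bigr => v _; rewrite maskE mask_pred1_cons /=.
  by rewrite (mask_pred1_notin _ (adjacent_lcas_head _ _ _)) cats0.
rewrite -(IH i.+1) //; congr (_ * _); rewrite !big_seq.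
apply: eq_bigr => -[|j v]; first by rewrite mem_forest_addresses_nil.
rewrite mem_forest_addresses_cons => /andP[lt _]; rewrite maskE mask_pred1_notin //.
by apply/negP => /mapP[q _ [E _]]; rewrite E ltnn in lt.
Qed.

Lemma tree_val_leaf m w : tree_val m (Node [::]) w = 1.
Proof. by rewrite /tree_val big_nil. Qed.

Lemma tree_val_Node m ss w : ss != [::] -> size w = (size (leaves (Node ss))).-1 ->
  tree_val m (Node ss) w = forest_val (tree_val m) m ss w.
Proof.
move=> ss0; rewrite /tree_val /sectors internal_vertices_Node // leaves_Node // => szw.
by rewrite big_cons (forest_val_prod _ _ (i := 0)) // size_adjacent_lcas.
Qed.

Lemma forest_valZ (c : tree -> K) G f ss w :
  forest_val (fun t u => c t * G t u) f ss w
  = (\prod_(s <- ss) c s) * forest_val G f ss w.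
Proof.
elim: ss f w => [|s ss IH] f w; first by rewrite [LHS]/= mulr0.
rewrite big_cons; case: ss IH => [|s' ss] IH.
  by rewrite big_nil mulr1 !forest_val1 mulrCA.
rewrite !forest_val_cons; case: (drop _ _) => [|x w']; first by rewrite mulr0.
rewrite IH; ring.
Qed.

(** The children of a vertex with [n] sectors below it. One child is allowed here:
it stands for the empty subword in a product. *)
Definition forest_ok n ss :=
  all is_schroder ss && (sumn [seq size (leaves s) | s <- ss] == n.+1).

Definition tree_ok n t := is_schroder t && (size (leaves t) == n.+1).

Lemma sum_nilp (L : seq tree) m (c : K) :
  \sum_(l <- seqs_upto L m | nilp l) c = c.
Proof.
case: m => [|m] /=; first by rewrite big_cons big_nil addr0.
rewrite big_cons /= big_mkcond big_allpairs_dep big1 ?addr0 // => s _.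
by rewrite big1.
Qed.

Lemma sumn_leaves_eq0 ss : (sumn [seq size (leaves s) | s <- ss] == 0%N) = nilp ss.
Proof. by case: ss => //= s ss; rewrite addn_eq0 gtn_eqF ?size_leaves_gt0. Qed.

(** Schroder forests are decompositions of a word into a subword and gaps together
with a Schroder tree on each gap. The induction peels off the first tree, as
[conv_first] peels off the first gap. *)
Lemma sum_forest_val L m G f w : (size w < m)%N ->
  let g u := \sum_(t <- L | tree_ok (size u) t) G t u in
  \sum_(ss <- seqs_upto L m | forest_ok (size w) ss) forest_val G f ss w = conv f g g w.
Proof.
move=> ltm g; elim: m f w ltm => // m IH f w; rewrite ltnS => lem.
case: w lem => [|x0 w0].
  move=> _; rewrite big_mkcond big_cons /= add0r big_allpairs_dep.
  rewrite /conv /g mulr_sumr [RHS]big_mkcond; apply: eq_bigr => s _ /=.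
  rewrite -[RHS](sum_nilp L m) [RHS]big_mkcond; apply: eq_bigr => l _.
  rewrite /forest_ok /tree_ok /=.
  have := size_leaves_gt0 s; case E : (size (leaves s)) => [//|k] _.
  rewrite addSn !eqSS addn_eq0 sumn_leaves_eq0.
  by case: l => [|s' l]; rewrite ?andbT ?andbF.
set w := x0 :: w0 => lem.
have ltd i : (size (drop i.+1 w) < m)%N.
  by rewrite (leq_trans _ lem) // size_drop ltn_subrL.
rewrite (conv_first _ _ _ _ x0) /=.
under [X in _ + X]eq_bigr => i _.
  rewrite -IH ?ltd //.
  rewrite /g size_takel ?(ltnW (ltn_ord i)) // size_drop mulr_suml.
  over.
rewrite /g mulr_sumr [X in X + _]big_mkcond.
under [X in _ + X]eq_bigr do rewrite big_mkcond.
rewrite exchange_big -big_split /= big_mkcond big_cons /= add0r big_allpairs_dep.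
apply: eq_bigr => s _ /=.
have := size_leaves_gt0 s; case szs: (size (leaves s)) => [//|k] _.
rewrite /forest_ok /tree_ok /= szs eqSS.
case: (is_schroder s) => /=; last first.
  by rewrite big1 // big1 ?addr0.
have [ltk|ltk|Ek] := ltngtP k (size w).
- rewrite add0r (bigD1 (Ordinal ltk)) //= eqxx [X in _ = _ + X]big1 ?addr0; last first.
    by move=> i; rewrite -val_eqE /= eqSS eq_sym => /negPf->.
  rewrite mulr_sumr [RHS]big_mkcond; apply: eq_bigr => l _.
  rewrite addSn eqSS -subSn //.
  have -> : (sumn [seq size (leaves t) | t <- l] == (size w - k)%N)
     = (k + sumn [seq size (leaves t) | t <- l] == size w)%N.
    by rewrite -(eqn_add2l k) subnKC // ltnW.
  case: l => [|s' l]; first by rewrite /= addn0 (ltn_eqF ltk) ?andbF.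
  by rewrite forest_val_cons szs (drop_nth x0 ltk).
- rewrite add0r big1 => [|l _]; last first.
    by rewrite addSn eqSS gtn_eqF ?andbF // ltn_addr.
  by rewrite big1 // => i _; rewrite eqSS gtn_eqF // (ltn_trans (ltn_ord i)).
rewrite [X in _ = _ + X]big1 ?addr0; last first.
  by move=> i _; rewrite eqSS gtn_eqF // Ek ltn_ord.
rewrite -[RHS](sum_nilp L m) [RHS]big_mkcond; apply: eq_bigr => l _.
rewrite addSn eqSS Ek -[X in _ == X]addn0 eqn_add2l sumn_leaves_eq0.
by case: l => [|s' l]; rewrite ?andbF // forest_val1.
Qed.

Lemma uniq_seqs_upto (U : eqType) (s : seq U) m : uniq s -> uniq (seqs_upto s m).
Proof.
move=> us; elim: m => //= m um; apply/andP; split.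
  by apply/negP => /allpairsPdep[x [l [_ _]]].
apply: allpairs_uniq => //; by move=> [x l] [y k] _ _ [-> ->].
Qed.

Lemma uniq_trees_upto d m : uniq (trees_upto d m).
Proof.
elim: d => //= d IH; rewrite map_inj_uniq; first exact: uniq_seqs_upto.
by move=> ? ? [].
Qed.

Definition tree_sum G w := \sum_(t : schroder_tree (size w)) G (val t) w.

(** The finite type of Schroder trees is enumerated by any large enough list of
trees, and those lists are built from lists of children. *)
Lemma tree_sumE G w d m : (size w < d)%N -> (size w < m)%N ->
  tree_sum G w = \sum_(t <- trees_upto d m | tree_ok (size w) t) G t w.
Proof.
move=> ltd ltm; rewrite -big_filter /tree_sum -big_enum /=.
rewrite -(big_map val xpredT (fun t => G t w)); apply: perm_big.
apply: uniq_perm.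
- by rewrite map_inj_uniq ?enum_uniq //; apply: val_inj.
- by rewrite filter_uniq ?uniq_trees_upto.
move=> t; rewrite mem_filter; apply/mapP/andP => [[u _ ->]|[tok _]].
  have uok := valP u; split => //; have /andP[uS /eqP un] := uok.
  by apply: mem_trees_upto; rewrite ?un.
by exists (SchroderTree tok); rewrite ?mem_enum.
Qed.

Lemma tree_sum_nil G : tree_sum G [::] = G (Node [::]) [::].
Proof.
by rewrite (@tree_sumE _ _ 1 1) //= big_mkcond !big_cons big_nil /= addr0.
Qed.

Lemma tree_sum_cons G w : (0 < size w)%N ->
  tree_sum G w =
  \sum_(ss <- seqs_upto (trees_upto (size w).+1 (size w).+1) (size w).+1
      | (1 < size ss)%N && forest_ok (size w) ss) G (Node ss) w.
Proof.
move=> w_gt0; rewrite (@tree_sumE _ _ (size w).+2 (size w).+1) ?leqnn // big_map.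
apply: eq_bigl => ss; rewrite /tree_ok /forest_ok.
have [->|ss0] := eqVneq ss [::]; first by rewrite /= eqSS (ltn_eqF w_gt0).
rewrite leaves_Node // size_forest_addresses -map_comp andbA /=.
by case: ss ss0.
Qed.

End TreeSums.

Section MonotoneLogarithm.
Variables (K : numFieldType) (T : Type) (m : seq T -> K).
Hypothesis m_nil : m [::] = 1.

(** A leaf is an empty gap and contributes the factor 1; it has no skeleton. *)
Definition order_weight N t :=
  if is_leaf t then 1%N else order_count (skeleton t) N.

Definition weighted_sum N w :=
  tree_sum (fun t u => (order_weight N t)%:R * tree_val m t u) w.

Lemma order_weight_Node N ss : ss != [::] ->
  order_weight N.+1 (Node ss)
  = (order_weight N (Node ss) + \prod_(s <- ss) order_weight N s)%N.
Proof.
case: ss => // s ss _; rewrite /order_weight /= -/(skeleton (Node (s :: ss))).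
rewrite order_countS; congr addn.
elim: (s :: ss) => [|t ts IH] /=; first by rewrite !big_nil.
rewrite big_cons /order_weight -IH; case: (is_leaf t) => /=; first by rewrite mul1n.
by rewrite big_cons.
Qed.

Lemma weighted_sum_nil N : weighted_sum N [::] = 1.
Proof. by rewrite /weighted_sum tree_sum_nil tree_val_leaf mulr1. Qed.

Lemma weighted_sum0 w : weighted_sum 0 w = conv_unit K w.
Proof.
case: w => [|x w]; first exact: weighted_sum_nil.
rewrite /weighted_sum /tree_sum big1 // => t _.
rewrite /order_weight; have /andP[_ /eqP tn] := valP t.
by case: (val t) tn => -[|s ss] //= _; rewrite order_count0 mul0r.
Qed.

(** The term [order_weight N] in [order_weight N.+1] is the contribution of the
empty subword, and the product over the children that of the nonempty
subwords. *)
Lemma weighted_sumS N w :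
  weighted_sum N.+1 w = conv m (weighted_sum N) (weighted_sum N) w.
Proof.
case: w => [|x0 w0]; first by rewrite /conv !weighted_sum_nil m_nil mulr1.
set w := x0 :: w0.
(* Splitting off the empty subword: [m] is [mp] plus the unit. *)
pose mp u := if u is [::] then 0 else m u.
have -> : conv m (weighted_sum N) (weighted_sum N) w
    = conv mp (weighted_sum N) (weighted_sum N) w + weighted_sum N w.
  rewrite -[X in _ + X](conv_unitl (weighted_sum N) (weighted_sum N)) -convDl.
  by apply: eq_conv => // -[|x u] _; rewrite /= ?m_nil ?add0r ?addr0.
rewrite {1 4}/weighted_sum !tree_sum_cons // addrC.
pose G t u := (order_weight N t)%:R * tree_val m t u.
set L := trees_upto _ _.
have -> : conv mp (weighted_sum N) (weighted_sum N) w =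
    \sum_(ss <- seqs_upto L (size w).+1 | (1 < size ss)%N && forest_ok (size w) ss)
       forest_val G m ss w.
  transitivity (\sum_(ss <- seqs_upto L (size w).+1 | forest_ok (size w) ss)
       forest_val G mp ss w).
    rewrite sum_forest_val //; apply: eq_conv => // u leu;
      by rewrite /weighted_sum -tree_sumE.
  rewrite big_mkcond [RHS]big_mkcond; apply: eq_bigr => -[|s [|s' ss]] _ //.
  by rewrite forest_val1 mul0r if_same.
rewrite -big_split big_seq_cond [RHS]big_seq_cond /=; apply: eq_bigr => ss.
case/and3P=> _ lt_ss /andP[_ /eqP lss].
have ss0 : ss != [::] by case: (ss) lt_ss.
rewrite order_weight_Node // natrD mulrDl; congr (_ + _).
rewrite forest_valZ -tree_val_Node //.
  by rewrite natr_prod.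
by rewrite leaves_Node // size_forest_addresses -map_comp lss.
Qed.

Variable h : seq T -> K.
Hypothesis flow_h : forall w, (flow h w).[1] = m w.

Lemma weighted_sumE N w : weighted_sum N w = (flow h w).[N%:R].
Proof.
elim: N w => [|N IH] w; first by rewrite weighted_sum0 flow_at0.
rewrite weighted_sumS -natr1 addrC flow_atS.
by apply: eq_conv => u _; rewrite ?flow_h ?IH.
Qed.

(** Both sides are the coefficients of X in two polynomials that agree at all natural
numbers: the flow, and the order polynomials of the skeletons expanded in binomial
coefficients. *)
Lemma log_flow w : (0 < size w)%N ->
  h w = tree_sum (fun t u => ratr (murua (skeleton t)) * tree_val m t u) w.
Proof.
case: w => // x w _; rewrite -flow_coef1.
have -> : flow h (x :: w) = \sum_(t : schroder_tree (size (x :: w)))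
   tree_val m t (x :: w) *: \sum_(1 <= k < (tree_size (skeleton t)).+1)
       (murua_k k (skeleton t))%:R *: bin_poly K k.
  apply: poly_eq_nat => N; rewrite -weighted_sumE /weighted_sum /tree_sum.
  rewrite horner_sum; apply: eq_bigr => t _; rewrite hornerZ mulrC; congr (_ * _).
  rewrite /order_weight; have /andP[_ /eqP tn] := valP t.
  have -> : is_leaf (val t) = false by case: (val t) tn => -[].
  rewrite order_countE natr_sum horner_sum; apply: eq_bigr => k _.
  by rewrite hornerZ horner_bin_poly natrM mulrC.
rewrite coef_sum /tree_sum; apply: eq_bigr => t _; rewrite coefZ mulrC; congr (_ * _).
rewrite /murua rmorph_sum coef_sum !big_nat; apply: eq_bigr => k /andP[k_gt0 _].
rewrite coefZ bin_poly_coef1 // mulrC rmorphM /= ratr_nat; congr (_ * _).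
by rewrite rmorphM rmorphXn rmorphN1 fmorphV /= ratr_nat.
Qed.

End MonotoneLogarithm.

(** * Nesting of blocks and the tree factorial *)

Local Open Scope nat_scope.

Section NoncrossingBlocks.
Variable n : nat.
Implicit Types (P : {set {set 'I_n}}) (D E V W : {set 'I_n}).

Lemma partition_blocksP P E : reflect
  [/\ forall W, W \in P -> W != set0 /\ W \subset E,
      forall x, x \in E -> exists2 W, W \in P & x \in W &
      forall V W x, V \in P -> W \in P -> x \in V -> x \in W -> V = W]
  (partition P E).
Proof.
apply: (iffP and3P) => [[/eqP cP tP P0]|[bP eP iP]]; split.
- move=> W WP; split; first by apply: contraNneq P0 => <-.
  by rewrite -cP; apply/subsetP => x xW; apply/bigcupP; exists W.
- by move=> x; rewrite -cP => /bigcupP[W WP xW]; exists W.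
- by move=> V W x VP WP xV xW; rewrite -(def_pblock tP VP xV) (def_pblock tP WP xW).
- apply/eqP/setP => x; apply/bigcupP/idP => [[W /bP[_ /subsetP WE] /WE] //|/eP[W WP xW]].
  by exists W.
- apply/trivIsetP => V W VP WP; apply: contraNT => /pred0Pn[x /andP[xV xW]].
  exact/eqP/(iP V W x).
- by apply/negP => /bP[]; rewrite eqxx.
Qed.

Lemma noncrossingP P : reflect
  (forall V W a b c d, V \in P -> W \in P -> V != W ->
     a \in V -> c \in V -> b \in W -> d \in W -> a < b -> b < c -> c < d -> False)
  (noncrossing P).
Proof.
apply: (iffP forall_inP) => [H V W a b c d VP WP VW aV cV bW dW ab bc cd|H V VP].
  have /forall_inP/(_ _ WP)/implyP/(_ VW) := H V VP.
  move/forall_inP/(_ a aV)/forall_inP/(_ b bW)/forall_inP/(_ c cV)/forall_inP/(_ d dW).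
  by rewrite ab bc cd.
apply/forall_inP => W WP; apply/implyP => VW.
apply/forall_inP => a aV; apply/forall_inP => b bW; apply/forall_inP => c cV.
apply/forall_inP => d dW; apply/negP => /and3P[ab bc cd].
exact: (H V W a b c d).
Qed.

Lemma block_max_mem V : V != set0 -> exists2 i, i \in V & block_max V = i.
Proof.
case/set0Pn => j jV.
have [|i iV E] := @eq_bigmax_cond _ (mem V) (fun i : 'I_n => i : nat).
  by apply/card_gt0P; exists j.
by exists i; last exact: E.
Qed.

Lemma block_maxP V i : i \in V -> i <= block_max V.
Proof. by move=> iV; rewrite /block_max (bigD1 i) //= leq_maxl. Qed.

Lemma nest_leP V W : V != set0 -> reflect
  (forall i, i \in W -> (exists2 a, a \in V & a <= i) /\ (exists2 b, b \in V & i <= b))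
  (nest_le V W).
Proof.
move=> V0; apply: (iffP forall_inP) => H i /H.
  have [a aV Ea] := block_min_mem V0; have [b bV Eb] := block_max_mem V0.
  by rewrite Ea Eb => /andP[ai ib]; split; [exists a | exists b].
case=> [[a' a'V a'i] [b' b'V ib']].
rewrite (leq_trans (block_minP a'V) a'i) /= (leq_trans ib') //.
exact: block_maxP.
Qed.

Lemma nest_le_refl V : nest_le V V.
Proof.
apply/forall_inP => i iV; rewrite block_minP //=.
exact: block_maxP.
Qed.

Section Partition.
Variables (P : {set {set 'I_n}}) (E : {set 'I_n}).
Hypotheses (pP : partition P E) (ncP : noncrossing P).

Lemma block_neq0 V : V \in P -> V != set0.
Proof. by case/partition_blocksP: pP => bP _ _ /bP[]. Qed.

Lemma block_inj V W x : V \in P -> W \in P -> x \in V -> x \in W -> V = W.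
Proof. by case/partition_blocksP: pP => _ _; apply. Qed.

Lemma nest_le_antisym V W : V \in P -> W \in P ->
  nest_le V W -> nest_le W V -> V = W.
Proof.
move=> VP WP VW WV.
have [i iV Ei] := block_min_mem (block_neq0 VP).
have [j jW Ej] := block_min_mem (block_neq0 WP).
have eij : i = j.
  apply/val_inj/eqP; rewrite /= -Ei -Ej eqn_leq.
  by rewrite (nest_le_min (block_neq0 WP) VW) (nest_le_min (block_neq0 VP) WV).
by apply: (block_inj VP WP iV); rewrite eij.
Qed.

(** Two incomparable blocks around a common third one would overlap, hence cross:
the nesting order is a forest. *)
Lemma nest_le_comparable V V' W : V \in P -> V' \in P -> W \in P ->
  nest_le V W -> nest_le V' W -> nest_le V V' \/ nest_le V' V.
Proof.
have wlog_min V1 V2 : V1 \in P -> V2 \in P -> W \in P ->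
    nest_le V1 W -> nest_le V2 W -> block_min V1 < block_min V2 -> nest_le V1 V2.
  move=> V1P V2P WP V1W V2W lt12.
  have V10 := block_neq0 V1P; have V20 := block_neq0 V2P.
  have [a aV Ea] := block_min_mem V10; have [b bV Eb] := block_max_mem V10.
  have [a' aV' Ea'] := block_min_mem V20.
  have [w wW] := set0Pn _ (block_neq0 WP).
  have neq : V1 != V2 by apply: contraTneq lt12 => ->; rewrite ltnn.
  apply/forall_inP => i iV2; rewrite (leq_trans (ltnW lt12) (block_minP iV2)) /=.
  rewrite leqNgt; apply/negP => ltbi.
  apply: (noncrossingP _ ncP V1 V2 a a' b i) => //; rewrite -?Ea -?Ea' -?Eb //.
  have : block_min V2 <= block_max V1.
    have /andP[_ wb] := forall_inP V1W w wW; have /andP[aw _] := forall_inP V2W w wW.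
    exact: leq_trans aw wb.
  rewrite leq_eqVlt => /orP[/eqP E12|//].
  have ab : a' = b by apply: val_inj; rewrite /= -Ea' -Eb.
  by case/eqP: neq; apply: (block_inj V1P V2P bV); rewrite -ab.
move=> VP V'P WP VW V'W.
case: (ltngtP (block_min V) (block_min V')) => [lt|lt|Emin].
- by left; apply: wlog_min.
- by right; apply: wlog_min.
have [a aV Ea] := block_min_mem (block_neq0 VP).
have [a' aV' Ea'] := block_min_mem (block_neq0 V'P).
left; suff -> : V = V' by apply: nest_le_refl.
apply: (block_inj VP V'P aV).
by have -> : a = a' by apply: val_inj; rewrite /= -Ea Emin.
Qed.

(** With [D] = [P] these are the roots, and with [D] the blocks nested strictly in V
they are the children of V. *)
Definition outermost (D : {set {set 'I_n}}) :=
  [set V in D | ~~ [exists U in D, nest_lt U V]].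

(** In a forest, every block of [D] lies below exactly one outermost block of
[D]. *)
Lemma big_outermost (R : Type) (idx : R) (op : Monoid.com_law idx)
    (D : {set {set 'I_n}}) (F : {set 'I_n} -> R) :
    D \subset P -> (forall V W, V \in D -> W \in P -> nest_le V W -> W \in D) ->
  \big[op/idx]_(W in D) F W
  = \big[op/idx]_(V in outermost D) \big[op/idx]_(W in P | nest_le V W) F W.
Proof.
move=> /subsetP DP Dup.
have exU W : W \in D -> exists2 V, V \in outermost D & nest_le V W.
  have [k] := ubnP #|[set U in D | nest_lt U W]|; elim: k W => // k IH W ltk WD.
  have [/exists_inP[U UD UW]|noU] := boolP [exists U in D, nest_lt U W]; last first.
    by exists W; rewrite ?nest_le_refl // inE WD.
  have UP := DP U UD; have WP := DP W WD; case/andP: (UW) => UneW UleW.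
  suff /IH[] : #|[set X in D | nest_lt X U]| < k => // [V Vout VU|].
    by exists V => //; apply: nest_le_trans VU UleW; apply: block_neq0.
  rewrite ltnS in ltk; apply: leq_trans ltk; apply: proper_card; apply/properP; split.
    apply/subsetP => X; rewrite !inE => /andP[XD /andP[neq XU]]; rewrite XD.
    rewrite /nest_lt (nest_le_trans (block_neq0 UP) XU UleW) andbT /=.
    apply: contraNneq neq => EX; rewrite EX in XU *.
    by rewrite (nest_le_antisym WP UP).
  by exists U; rewrite !inE ?UD // /nest_lt eqxx.
(* [p W] is the outermost block around [W]. *)
pose p W := odflt W [pick V in outermost D | nest_le V W].
have uniqV V W : V \in outermost D -> W \in P -> nest_le V W -> p W = V.
  move=> Vout WP VW; rewrite /p; case: pickP => [V' /andP[V'out V'W]|/(_ V)]; last first.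
    by rewrite Vout VW.
  move: Vout V'out; rewrite !inE => /andP[VD Vm] /andP[V'D V'm] /=.
  apply: contraTeq isT => neq.
  have [VV'|V'V] := nest_le_comparable (DP _ VD) (DP _ V'D) WP VW V'W.
    by case/exists_inP: V'm; exists V; rewrite // /nest_lt eq_sym neq.
  by case/exists_inP: Vm; exists V'; rewrite // /nest_lt neq.
rewrite (partition_big p (mem (outermost D))) => [|W WD] /=; last first.
  by have [V Vout VW] := exU W WD; rewrite (uniqV V) // DP.
apply: eq_bigr => V Vout; apply: eq_bigl => W.
apply/andP/andP => [[WD /eqP EpW]|[WP VW]].
  have [V' V'out V'W] := exU W WD.
  by rewrite -EpW (uniqV V') ?DP.
have VD : V \in D by move: Vout; rewrite inE => /andP[].
by rewrite (Dup V) // (uniqV V).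
Qed.

(** The number of vertices of the subtree of the forest of nestings with root [V]. *)
Definition hook V := #|[set W in P | nest_le V W]|.

Lemma hook_gt0 V : V \in P -> 0 < hook V.
Proof. by move=> VP; apply/card_gt0P; exists V; rewrite inE VP nest_le_refl. Qed.

Lemma big_below (R : Type) (idx : R) (op : Monoid.com_law idx) V
    (F : {set 'I_n} -> R) : V \in P ->
  \big[op/idx]_(W in P | nest_le V W) F W
  = op (F V) (\big[op/idx]_(V' in nest_children P V)
               \big[op/idx]_(W in P | nest_le V' W) F W).
Proof.
move=> VP; rewrite (bigD1 V) /= ?VP ?nest_le_refl //; congr (op _ _).
pose D := [set W in P | nest_lt V W].
transitivity (\big[op/idx]_(W in D) F W).
  by apply: eq_bigl => W; rewrite inE /nest_lt andbA andbAC eq_sym.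
rewrite big_outermost.
- apply: eq_bigl => W; rewrite !inE -andbA; congr [&& _, _ & ~~ _].
  by apply: eq_existsb => U; rewrite inE andbA.
- by apply/subsetP => W; rewrite inE => /andP[].
move=> W W'; rewrite !inE => /and3P[WP VneW VW] W'P WW'.
rewrite W'P /nest_lt (nest_le_trans (block_neq0 WP) VW WW') andbT /=.
apply: contraNneq VneW => EV; rewrite -EV in WW'.
by rewrite (nest_le_antisym VP WP).
Qed.

Lemma hookE V : hook V = \sum_(W in P | nest_le V W) 1.
Proof. by rewrite /hook -sum1_card; apply: eq_bigl => W; rewrite inE. Qed.

Lemma sum_hook_roots : \sum_(V in nest_roots P) hook V = #|P|.
Proof.
rewrite -sum1_card (big_outermost _ _ (subxx P)); last by move=> V W _ ->.
by apply: eq_bigr => V _; rewrite hookE.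
Qed.

End Partition.

Lemma tree_size_Node ts : tree_size (Node ts) = (\sum_(t <- ts) tree_size t).+1.
Proof.
by rewrite /tree_size /= size_addresses_below -map_comp sumnE big_map.
Qed.

Lemma tree_fact_Node ts :
  tree_fact (Node ts) = tree_size (Node ts) * \prod_(t <- ts) tree_fact t.
Proof. by rewrite /= foldrE big_map. Qed.

(** The hook form of the tree factorial: unfolding the recursion gives one factor
for each block, the size of its subtree. *)
Lemma forest_fact_hook P : P \in NC n ->
  forest_fact (nest_forest P) = \prod_(V in P) hook P V.
Proof.
rewrite inE => /andP[pP ncP].
have nest_treeP V : V \in P ->
    tree_size (nest_tree P V) = hook P V /\
    tree_fact (nest_tree P V) = \prod_(W in P | nest_le V W) hook P W.
  have [k] := ubnP #|[set U in P | nest_lt V U]|; elim: k V => // k IH V ltk VP.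
  have IHc W : W \in nest_children P V ->
      tree_size (nest_tree P W) = hook P W /\
      tree_fact (nest_tree P W) = \prod_(U in P | nest_le W U) hook P U.
    rewrite inE => /and3P[WP VW _]; apply: IH => //.
    exact: leq_trans (nest_lt_card pP VP WP VW) ltk.
  have szV : tree_size (nest_tree P V) = hook P V.
    rewrite nest_treeE // tree_size_Node big_map big_enum hookE //.
    rewrite (big_below pP ncP) //=; congr (_.+1).
    by apply: eq_bigr => W /IHc[-> _]; rewrite hookE.
  split=> //; rewrite {1}nest_treeE // tree_fact_Node -nest_treeE // szV.
  rewrite (big_below pP ncP) //= big_map big_enum; congr (_ * _).
  by apply: eq_bigr => W /IHc[].
rewrite /forest_fact big_map big_enum.
rewrite [RHS](big_outermost pP ncP _ _ (subxx P)); last by move=> V W _ ->.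
apply: eq_bigr => V; rewrite inE => /andP[VP _].
by case: (nest_treeP V VP).
Qed.

End NoncrossingBlocks.

(** * Sums over noncrossing partitions *)

Section OrdSets.
Variable n : nat.
Implicit Types (E V W : {set 'I_n}) (x : 'I_n).

Definition before x E := [set y in E | y < x].
Definition after x E := [set y in E | x < y].

(** Sorted lists are determined by their elements, so the enumeration of a set can be
cut at any of its elements. *)
Lemma enum_split x E : x \in E -> enum E = enum (before x E) ++ x :: enum (after x E).
Proof.
move=> xE; apply: (@irr_sorted_eq _ (fun i j : 'I_n => i < j)).
- by move=> y u v; apply: ltn_trans.
- by move=> y; apply: ltnn.
- exact: sorted_enum_ord.
- rewrite -[sorted _ _](sorted_map (f := val) (e' := ltn)) sorted_pairwise;
  last exact: ltn_trans.
  rewrite map_cat pairwise_cat /= -!sorted_pairwise; try exact: ltn_trans.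
  rewrite !sorted_map !sorted_enum_ord !andbT; apply/and3P; split => //.
    apply/allrelP => ? t /mapP[y + ->]; rewrite mem_enum !inE => yb /predU1P[->|].
      by case/andP: yb.
    case/mapP=> z; rewrite mem_enum inE => /andP[_ xz] ->; apply: ltn_trans xz.
    by case/andP: yb.
  by apply/allP => t /mapP[z]; rewrite mem_enum inE => /andP[_ xz] ->.
move=> y; rewrite mem_cat inE !mem_enum !inE.
rewrite -(val_eqE y) /=.
by case: (ltngtP y x) => [||/val_inj->]; rewrite ?andbT ?andbF ?orbF ?xE.
Qed.

Lemma before_min x V : (forall y, y \in V -> x < y) -> before x (x |: V) = set0.
Proof.
move=> ltV; apply/setP => y; rewrite !inE; case: eqVneq => [->|_] /=;
  first by rewrite ltnn.
by apply/negP => /andP[/ltV/ltnW]; rewrite leqNgt => /negbTE->.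
Qed.

Lemma after_min x V : (forall y, y \in V -> x < y) -> after x (x |: V) = V.
Proof.
move=> ltV; apply/setP => y; rewrite !inE; case: eqVneq => [->|_] /=.
  by rewrite ltnn; apply/esym/negP => /ltV; rewrite ltnn.
by apply/andP/idP => [[]|yV] //; rewrite yV ltV.
Qed.

Lemma enum_min x V : (forall y, y \in V -> x < y) -> enum (x |: V) = x :: enum V.
Proof.
move=> ltV; rewrite (enum_split (setU11 x V)) before_min // after_min //.
by rewrite enum_set0.
Qed.

Lemma set_of_enum E : [set:: enum E] = E.
Proof. by apply/setP => x; rewrite inE mem_enum. Qed.

End OrdSets.

Section PartitionSums.
Variables (K : numFieldType) (n : nat) (h : seq 'I_n -> K).
Implicit Types (P : {set {set 'I_n}}) (D E V W : {set 'I_n}).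

Definition nc_partitions E := [set P | partition P E && noncrossing P].

Definition separated V P := [exists W in P, exists a in W, exists v in V,
  exists b in W, (a < v) && (v < b)].

Lemma separatedP V P : reflect
  (exists W a v b, [/\ W \in P, a \in W, v \in V & b \in W] /\ (a < v < b))
  (separated V P).
Proof.
apply: (iffP exists_inP) => [[W WP]|[W [a [v [b [[WP aW vV bW] avb]]]]]].
  case/exists_inP => a aW /exists_inP[v vV /exists_inP[b bW avb]].
  by exists W, a, v, b.
exists W => //; apply/exists_inP; exists a => //; apply/exists_inP; exists v => //.
by apply/exists_inP; exists b.
Qed.

(** Noncrossing partitions of the complement of [V] that refine the decomposition
into the gaps of [V]. *)
Definition gap_partitions E V := [set P in nc_partitions (E :\: V) | ~~ separated V P].

Lemma gap_partitions0 E : gap_partitions E set0 = nc_partitions E.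
Proof.
apply/setP => P; rewrite !inE setD0 andbC; case: separatedP => //.
by case=> W [a [v [b [[_ _]]]]]; rewrite inE.
Qed.

(** If [V] separates a block W, then, as they do not cross, [V] lies between two
elements of W and is not a root. Conversely, [V] separates any block around it, and
any block that it crosses. *)
Lemma root_gap E V P : V != set0 -> V \subset E ->
  (V |: P \in nc_partitions E) && (V \in nest_roots (V |: P)) && (V \notin P)
  = (P \in gap_partitions E V).
Proof.
move=> V0 VE; rewrite !inE eqxx /=; apply/idP/idP.
  case/andP=> /andP[/andP[pP ncP] noU] VP; have [bP eP iP] := partition_blocksP _ _ pP.
  have VU : V \in V |: P by rewrite !inE eqxx.
  have WU W : W \in P -> W \in V |: P by rewrite !inE => ->; rewrite orbT.
  have disj W x : W \in P -> x \in W -> x \notin V.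
    move=> WP xW; apply: contra VP => xV.
    by rewrite -(iP W V x (WU _ WP) VU xW xV).
  apply/andP; split; first (apply/andP; split).
  - apply/partition_blocksP; split=> [W WP|x|W1 W2 x W1P W2P].
    + have [W0 /subsetP WE] := bP W (WU _ WP); split=> //.
      by apply/subsetP => x xW; rewrite inE (disj W) ?WE.
    + rewrite inE => /andP[xV /eP[W]]; rewrite !inE => /predU1P[-> xV'|WP xW].
        by rewrite xV' in xV.
      by exists W.
    + by apply: iP; apply: WU.
  - apply/noncrossingP => W1 W2 a b c d /WU W1U /WU W2U.
    exact: (noncrossingP _ ncP).
  apply/separatedP => -[W [a [v [b [[WP aW vV bW] /andP[av vb]]]]]].
  have WneV : W != V by apply: contraNneq VP => <-.
  case/exists_inP: noU; exists W; rewrite ?WU // /nest_lt WneV /=.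
  have [W0 _] := bP W (WU _ WP); apply/(nest_leP _ W0) => i iV; split.
    exists a => //; rewrite leqNgt; apply/negP => ia.
    by apply: (noncrossingP _ ncP V W i a v b VU (WU _ WP)); rewrite // eq_sym.
  exists b => //; rewrite leqNgt; apply/negP => bi.
  exact: (noncrossingP _ ncP W V a v b i (WU _ WP)).
case/andP=> /andP[pP ncP] nsep; have [bP eP iP] := partition_blocksP _ _ pP.
have disj W x : W \in P -> x \in W -> x \notin V.
  by move=> /bP[_ /subsetP WE] /WE; rewrite inE => /andP[].
have VP : V \notin P.
  apply/negP => VP; have [x xV] := set0Pn _ V0.
  by have := disj V x VP xV; rewrite xV.
have sep W a v b : W \in P -> a \in W -> v \in V -> b \in W -> a < v -> v < b -> False.
  move=> WP aW vV bW av vb; case/separatedP: nsep; exists W, a, v, b.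
  by rewrite av vb.
have pU : partition (V |: P) E.
  apply/partition_blocksP; split=> [W|x xE|W1 W2 x].
  - rewrite !inE => /predU1P[->|/bP[W0 WE]] //; split=> //.
    exact: subset_trans WE (subsetDl _ _).
  - have [xV|xV] := boolP (x \in V); first by exists V; rewrite ?setU11.
    have [|W WP xW] := eP x; first by rewrite inE xV.
    by exists W => //; rewrite !inE WP orbT.
  rewrite !inE => /predU1P[->|W1P] /predU1P[->|W2P] // x1 x2.
  - by have := disj _ _ W2P x2; rewrite x1.
  - by have := disj _ _ W1P x1; rewrite x2.
  exact: iP x1 x2.
rewrite pU VP andbT /=; apply/andP; split.
  apply/noncrossingP => W1 W2 a b c d; rewrite !inE => /predU1P[->|W1P] /predU1P[->|W2P].
  - by rewrite eqxx.
  - by move=> _ aV cV bW dW ab bc cd; apply: (sep W2 b c d).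
  - by move=> _ aV cV bW dW ab bc cd; apply: (sep W1 a b c).
  exact: (noncrossingP _ ncP).
apply/exists_inP => -[W]; rewrite !inE => /predU1P[->|WP]; first by rewrite /nest_lt eqxx.
case/andP=> _; have [W0 _] := bP W WP; have [v vV] := set0Pn _ V0.
case/(nest_leP _ W0)/(_ v vV) => -[a aW av] [b bW vb].
have vW : v \notin W by apply/negP => vW; have := disj _ _ WP vW; rewrite vV.
apply: (sep W a v b) => //; rewrite ltn_neqAle ?av ?vb andbT.
  by apply: contraNneq vW => /val_inj<-.
by apply: contraNneq vW => /val_inj->.
Qed.

Local Open Scope ring_scope.

(** By [forest_fact_hook] this is the monomial X^|P| / t(P)! times the value of the
cumulants on [P]. *)
Definition weight P : {poly K} :=
  (\prod_(V in P) (h (enum V) / (hook P V)%:R)) *: 'X^#|P|.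

Definition nc_sum E := \sum_(P in nc_partitions E) weight P.

(** The hooks of the roots add up to #|P|, the factor that the derivative produces, and
the hook of each root cancels its own denominator. Removing a root leaves the hooks of
the other blocks unchanged. *)
Lemma deriv_weight E P : P \in nc_partitions E ->
  (weight P)^`() = \sum_(V in nest_roots P) h (enum V) *: weight (P :\ V).
Proof.
rewrite inE => /andP[pP ncP].
rewrite /weight derivZ derivXn -[X in _ *+ X](sum_hook_roots pP ncP) -scaler_nat natr_sum.
rewrite scaler_suml scaler_sumr; apply: eq_bigr => V.
rewrite inE => /andP[VP /exists_inP Vroot].
have -> : #|P|.-1 = #|P :\ V| by rewrite (cardsD1 V) VP.
rewrite !scalerA; congr (_ *: _); rewrite (big_setD1 V) //=.
have -> : \prod_(W in P :\ V) (h (enum W) / (hook (P :\ V) W)%:R)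
        = \prod_(W in P :\ V) (h (enum W) / (hook P W)%:R).
  apply: eq_bigr => W; rewrite !inE => /andP[WneV WP]; congr (_ / _%:R).
  apply: eq_card => X; rewrite !inE; case: eqVneq => //= ->.
  rewrite VP /=; apply/esym/negP => WV; apply: Vroot; exists W => //.
  by rewrite /nest_lt WneV.
rewrite mulrAC; congr (_ * _); rewrite divfK //.
by rewrite pnatr_eq0 -lt0n hook_gt0.
Qed.

Lemma deriv_nc_sum E : (nc_sum E)^`() =
  \sum_(V : {set 'I_n} | (V \subset E) && (V != set0))
     (h (enum V))%:P * \sum_(P in gap_partitions E V) weight P.
Proof.
rewrite /nc_sum raddf_sum /= (eq_bigr _ (@deriv_weight E)).
rewrite (exchange_big_dep (fun V : {set 'I_n} => (V \subset E) && (V != set0))) /=;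
  last first.
  move=> P V; rewrite inE => /andP[/partition_blocksP[bP _ _] _].
  by rewrite inE => /andP[/bP[-> ->]].
apply: eq_bigr => V /andP[VE V0].
rewrite (reindex_onto (fun P => V |: P) (fun P => P :\ V)) /=; last first.
  by move=> P; rewrite inE => /andP[_]; rewrite inE => /andP[VP _]; rewrite setD1K.
rewrite mulr_sumr; apply: eq_big => [P|P].
  rewrite -root_gap //; congr (_ && _).
  apply/eqP/idP => [<-|VP]; first by rewrite !inE eqxx.
  by rewrite setU1K.
by case/andP=> _ /eqP ->; rewrite mul_polyC.
Qed.

Lemma nc_partitions_set0 P : (P \in nc_partitions set0) = (P == set0).
Proof.
apply/idP/eqP => [|->].
  rewrite inE => /andP[/partition_blocksP[bP _ _] _]; apply/setP => W; rewrite inE.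
  by apply/negP => /bP[/negP W0]; rewrite subset0.
rewrite inE; apply/andP; split; last by apply/noncrossingP => V W a b c d; rewrite inE.
by apply/partition_blocksP; split=> [W|x|V W x]; rewrite inE.
Qed.

Lemma nc_sum0 : nc_sum set0 = 1.
Proof.
rewrite /nc_sum (big_pred1 set0) => [|P]; last by rewrite nc_partitions_set0.
by rewrite /weight big_set0 cards0 scale1r.
Qed.

Lemma nc_sum_at0 E : (nc_sum E).[0] = (E == set0)%:R.
Proof.
have [->|E0] := eqVneq; first by rewrite nc_sum0 hornerC.
rewrite horner_sum big1 // => P; rewrite inE => /andP[/partition_blocksP[_ eP _] _].
have [x /eP[W WP _]] := set0Pn _ E0.
by rewrite hornerZ hornerXn expr0n cards_eq0; case: eqP WP => [->|]; rewrite ?inE ?mulr0.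
Qed.

Definition blocks_in E P := forall W, W \in P -> W != set0 /\ W \subset E.

(** No block of one family is nested in a block of the other, so that the hooks are
computed separately. *)
Lemma weight_setU (U R : {set 'I_n}) P1 P2 :
    (forall y z, y \in U -> z \in R -> (y < z)%N) ->
    blocks_in U P1 -> blocks_in R P2 ->
  weight (P1 :|: P2) = weight P1 * weight P2.
Proof.
move=> ltUR b1 b2.
have far W X : W \in P1 -> X \in P2 ->
    [/\ (nest_le W X) = false, (nest_le X W) = false & W != X].
  move=> /b1[W0 /subsetP WU] /b2[X0 /subsetP XR].
  have [w wW] := set0Pn _ W0; have [z zX] := set0Pn _ X0.
  split.
  - apply/negP => /(nest_leP _ W0)/(_ z zX)[_ [b /WU bU]].
    by rewrite leqNgt ltUR ?XR.
  - apply/negP => /(nest_leP _ X0)/(_ w wW)[[a /XR aR] + _].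
    by rewrite leqNgt ltUR ?WU.
  by apply/eqP => E; have := ltUR w w (WU _ wW); rewrite ltnn XR -?E // => /(_ isT).
have disj : [disjoint P1 & P2].
  apply/pred0P => W /=; apply/negP => /andP[W1 W2].
  by have [_ _] := far W W W1 W2; rewrite eqxx.
rewrite /weight -scalerAl -scalerAr scalerA -exprD; congr (_ *: 'X^ _).
  rewrite (eq_bigl (mem [predU P1 & P2])); last by move=> W; rewrite !inE.
  rewrite bigU //=; congr (_ * _); apply: eq_bigr => W WP; congr (_ / _%:R).
    apply: eq_card => X; rewrite !inE; case: (boolP (X \in P2)) => [XP|];
      last by rewrite orbF.
    by have [-> _ _] := far W X WP XP; rewrite !andbF.
  apply: eq_card => X; rewrite !inE; case: (boolP (X \in P1)) => //= XP.
  by have [_ -> _] := far X W XP WP; rewrite andbF.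
by rewrite cardsU disjoint_setI0 // cards0 subn0.
Qed.

Lemma noncrossing_subset P P' : P' \subset P -> noncrossing P -> noncrossing P'.
Proof.
move=> /subsetP sP /noncrossingP H; apply/noncrossingP => V W a b c d /sP VP /sP WP.
exact: H.
Qed.

Lemma nc_partitions_blocks E P : P \in nc_partitions E -> blocks_in E P.
Proof. by rewrite inE => /andP[/partition_blocksP[]]. Qed.

Section GapSplit.
Variables (x : 'I_n) (E V : {set 'I_n}).
Hypotheses (xE : x \in E) (VR : V \subset after x E).

Let ltV y : y \in V -> (x < y)%N.
Proof. by move/(subsetP VR); rewrite inE => /andP[]. Qed.

(** A block that meets both sides of [x] would be separated by [x]. *)
Lemma gap_block_side P W : P \in gap_partitions E (x |: V) -> W \in P ->
  (W \subset before x E) || (W \subset after x E).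
Proof.
rewrite inE => /andP[Pnc nsep] WP; have [W0 /subsetP WE] := nc_partitions_blocks Pnc WP.
have WEx y : y \in W -> y \in E /\ y != x.
  by move/WE; rewrite !inE negb_or => /andP[/andP[]].
apply: contraNT nsep; rewrite negb_or => /andP[/subsetPn[b bW bU] /subsetPn[a aW aR]].
have [aE anex] := WEx a aW; have [bE bnex] := WEx b bW.
apply/separatedP; exists W, a, x, b; rewrite setU11; split=> //.
move: bU aR; rewrite !inE aE bE /= -!leqNgt => xb ax.
rewrite ltn_neqAle ax andbT (inj_eq val_inj) anex /=.
by rewrite ltn_neqAle xb andbT (inj_eq val_inj) eq_sym.
Qed.

Lemma gap_setU P1 P2 : P1 \in nc_partitions (before x E) -> P2 \in gap_partitions
  (after x E) V ->
  P1 :|: P2 \in gap_partitions E (x |: V).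
Proof.
move=> P1nc; rewrite inE => /andP[P2nc nsep].
have b1 := nc_partitions_blocks P1nc; have b2 := nc_partitions_blocks P2nc.
move: P1nc P2nc; rewrite inE => /andP[/partition_blocksP[_ e1 i1] /noncrossingP n1].
rewrite inE => /andP[/partition_blocksP[_ e2 i2] /noncrossingP n2].
have in1 W y : W \in P1 -> y \in W -> y \in E /\ (y < x)%N.
  by move=> /b1[_ /subsetP WU] /WU; rewrite inE => /andP[].
have in2 W y : W \in P2 -> y \in W -> [/\ y \in E, y \notin V & (x < y)%N].
  by move=> /b2[_ /subsetP WU] /WU; rewrite !inE => /and3P[].
rewrite inE inE -andbA; apply/and3P; split.
- apply/partition_blocksP; split.
  + move=> W; rewrite inE => /orP[WP|WP].
      have [W0 _] := b1 W WP; split=> //; apply/subsetP => y yW.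
      have [yE ltyx] := in1 W y WP yW; rewrite !inE yE andbT negb_or.
      apply/andP; split; first by apply: contraTneq ltyx => ->; rewrite ltnn.
      by apply: contraTN ltyx => /ltV/ltnW; rewrite -leqNgt.
    have [W0 _] := b2 W WP; split=> //; apply/subsetP => y yW.
    have [yE yV ltxy] := in2 W y WP yW; rewrite !inE yE (negPf yV) orbF andbT.
    by apply: contraTneq ltxy => ->; rewrite ltnn.
  + move=> y; rewrite !inE negb_or => /andP[/andP[ynex yV] yE].
    case: (ltngtP y x) => [ltyx|ltxy|/val_inj Eyx]; last by rewrite Eyx eqxx in ynex.
      by have [|W WP yW] := e1 y; [rewrite inE yE | exists W; rewrite // inE WP].
    by have [|W WP yW] := e2 y; [rewrite !inE yV yE | exists W; rewrite // inE WP orbT].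
  move=> W1 W2 y; rewrite !inE => /orP[W1P|W1P] /orP[W2P|W2P] y1 y2.
  + exact: i1 y1 y2.
  + have [_ lt1] := in1 _ _ W1P y1; have [_ _ lt2] := in2 _ _ W2P y2.
    by have := ltn_trans lt1 lt2; rewrite ltnn.
  + have [_ lt1] := in1 _ _ W2P y2; have [_ _ lt2] := in2 _ _ W1P y1.
    by have := ltn_trans lt1 lt2; rewrite ltnn.
  + exact: i2 y1 y2.
- apply/noncrossingP => W1 W2 a b c d;
  rewrite !inE => /orP[W1P|W1P] /orP[W2P|W2P] ne aW cW bW dW ab bc cd.
  + exact: (n1 W1 W2 a b c d).
  + have [_ lt1] := in1 _ _ W1P cW; have [_ _ lt2] := in2 _ _ W2P bW.
    by have := ltn_trans (ltn_trans lt1 lt2) bc; rewrite ltnn.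
  + have [_ lt1] := in1 _ _ W2P bW; have [_ _ lt2] := in2 _ _ W1P aW.
    by have := ltn_trans (ltn_trans lt1 lt2) ab; rewrite ltnn.
  + exact: (n2 W1 W2 a b c d).
apply/separatedP => -[W [a [v [b [[WP aW vV bW] /andP[av vb]]]]]].
move: WP vV; rewrite !inE => /orP[WP|WP] /predU1P[Ev|vV].
- by have [_] := in1 _ _ WP bW; rewrite -Ev ltnNge ltnW.
- by have [_ lt] := in1 _ _ WP bW; have := ltn_trans vb (ltn_trans lt (ltV vV));
  rewrite ltnn.
- by have [_ _] := in2 _ _ WP aW; rewrite -Ev ltnNge ltnW.
by case/separatedP: nsep; exists W, a, v, b; rewrite av vb.
Qed.

Lemma gap_before P : P \in gap_partitions E (x |: V) ->
  [set W in P | W \subset before x E] \in nc_partitions (before x E).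
Proof.
move=> Pgap; have side W := @gap_block_side P W Pgap.
move: Pgap; rewrite !inE => /andP[/andP[/partition_blocksP[bP eP iP] ncP] _].
apply/andP; split; last first.
  by apply: noncrossing_subset ncP; apply/subsetP => W; rewrite inE => /andP[].
apply/partition_blocksP; split.
- by move=> W; rewrite inE => /andP[/bP[]].
- move=> y; rewrite inE => /andP[yE ltyx].
  have [|W WP yW] := eP y.
    rewrite !inE yE andbT negb_or; apply/andP; split.
      by apply: contraTneq ltyx => ->; rewrite ltnn.
    by apply: contraTN ltyx => /ltV/ltnW; rewrite -leqNgt.
  exists W => //; rewrite inE WP /=; case/orP: (side W WP) => // /subsetP/(_ y yW).
  by rewrite inE ltnNge (ltnW ltyx) andbF.
by move=> W1 W2 y; rewrite !inE => /andP[? _] /andP[? _]; apply: iP.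
Qed.

Lemma gap_after P : P \in gap_partitions E (x |: V) ->
  [set W in P | W \subset after x E] \in gap_partitions (after x E) V.
Proof.
move=> Pgap; have side W := @gap_block_side P W Pgap.
move: Pgap; rewrite !inE => /andP[/andP[/partition_blocksP[bP eP iP] ncP] nsep].
rewrite -andbA; apply/and3P; split; last first.
- apply: contra nsep => /separatedP[W [a [v [b [[WP aW vV bW] avb]]]]].
  apply/separatedP; exists W, a, v, b; split=> //; split=> //.
    by move: WP; rewrite inE => /andP[].
  by rewrite !inE vV orbT.
- by apply: noncrossing_subset ncP; apply/subsetP => W; rewrite inE => /andP[].
apply/partition_blocksP; split.
- move=> W; rewrite inE => /andP[/bP[W0 /subsetP WE] /subsetP WR]; split=> //.
  apply/subsetP => y yW; rewrite inE WR // andbT.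
  by have := WE y yW; rewrite !inE negb_or => /andP[/andP[]].
- move=> y; rewrite !inE => /and3P[yV yE ltxy].
  have [|W WP yW] := eP y.
    rewrite !inE yE (negPf yV) orbF andbT.
    by apply: contraTneq ltxy => ->; rewrite ltnn.
  exists W => //; rewrite inE WP /=; case/orP: (side W WP) => // /subsetP/(_ y yW).
  by rewrite inE ltnNge (ltnW ltxy) andbF.
by move=> W1 W2 y; rewrite !inE => /andP[? _] /andP[? _]; apply: iP.
Qed.

(** Splits off the first gap of a subset whose smallest element is [x]. *)
Lemma weight_gap :
  \sum_(P in gap_partitions E (x |: V)) weight P
  = nc_sum (before x E) * \sum_(P in gap_partitions (after x E) V) weight P.
Proof.
have ltUR y z : y \in before x E -> z \in after x E -> (y < z)%N.
  by rewrite !inE => /andP[_ yx] /andP[_ xz]; apply: ltn_trans xz.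
have gap_blocks P : P \in gap_partitions (after x E) V -> blocks_in (after x E) P.
  rewrite inE => /andP[/nc_partitions_blocks bP _] W /bP[W0 WR]; split=> //.
  exact: subset_trans WR (subsetDl _ _).
rewrite /nc_sum big_distrlr /= pair_big_dep /=.
rewrite (reindex_onto (fun p => p.1 :|: p.2)
  (fun P => ([set W in P | W \subset before x E], [set W in P | W \subset after x E])));
  last first.
  move=> P Pgap; apply/setP => W; rewrite !inE -andb_orr.
  by case WP: (W \in P) => //=; apply: (gap_block_side Pgap).
have inv p1 p2 : p1 \in nc_partitions (before x E) -> p2 \in gap_partitions (after x
  E) V ->
    [set W in p1 :|: p2 | W \subset before x E] = p1 /\
    [set W in p1 :|: p2 | W \subset after x E] = p2.
  move=> /nc_partitions_blocks b1 /gap_blocks b2.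
  have excl W : W != set0 -> W \subset before x E -> W \subset after x E -> False.
    case/set0Pn => w wW /subsetP/(_ w wW) wU /subsetP/(_ w wW) wR.
    by have := ltUR w w wU wR; rewrite ltnn.
  split; apply/setP => W; rewrite !inE; apply/andP/idP => [[/orP[WP|WP] sW]|WP] //.
  - by have [W0 sW'] := b2 W WP; case: (excl W).
  - by rewrite WP; have [] := b1 W WP.
  - by have [W0 sW'] := b1 W WP; case: (excl W).
  - by rewrite WP orbT; have [] := b2 W WP.
apply: eq_big => -[p1 p2] /=.
  apply/andP/andP => [[Pgap /eqP[E1 E2]]|[P1 P2]].
    by rewrite -{1}E1 -{2}E2; split; [apply: gap_before | apply: gap_after].
  by have [-> ->] := inv _ _ P1 P2; rewrite gap_setU.
case/andP=> Pgap /eqP[E1 E2]; apply: (weight_setU ltUR).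
  by apply: nc_partitions_blocks; rewrite -E1; apply: gap_before.
by apply: gap_blocks; rewrite -E2; apply: gap_after.
Qed.

End GapSplit.

(** Sums over subsets are products of functions on words: sorting the subsets by
their smallest element matches [conv_first]. The function [g] is constrained only on
subsets of [E], because only sorted words come from sets. *)
Lemma conv_nc_sum (f g : seq 'I_n -> {poly K}) E :
    (forall D, D \subset E -> g (enum D) = nc_sum D) ->
  \sum_(V : {set 'I_n} | V \subset E) f (enum V) * \sum_(P in gap_partitions E V) weight P
  = conv f g g (enum E).
Proof.
have [k] := ubnP #|E|; elim: k f E => // k IH f E ltk gE.
rewrite (bigD1 set0) ?sub0set //= gap_partitions0 enum_set0 -/(nc_sum E).
case defE: (enum E) => [|x0 s].
  have E0 : E = set0 by rewrite -[E]set_of_enum defE; apply/setP => x; rewrite !inE.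
  rewrite [X in _ + X]big1 ?addr0 => [|V]; last first.
    by case/andP=> + V0; rewrite E0 subset0 (negPf V0).
  by rewrite /conv -defE gE.
rewrite (conv_first _ _ _ _ x0) -defE gE //; congr (_ + _).
rewrite (partition_big (fun V => head x0 (enum V)) (mem E)) /=; last first.
  move=> V /andP[/subsetP VE V0]; rewrite -mem_enum.
  case defV: (enum V) => [|x u] /=.
    by case/set0Pn: V0 => x; rewrite -mem_enum defV.
  by rewrite mem_enum VE // -mem_enum defV mem_head.
rewrite -[LHS]big_enum /= (big_nth x0) big_mkord; apply: eq_bigr => -[i lti] _ /=.
set x := nth x0 (enum E) i.
have xE : x \in E by rewrite -mem_enum mem_nth.
have szi : size (enum (before x E)) = i.
  have : index x (enum E) = i by rewrite index_uniq ?enum_uniq.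
  rewrite (enum_split xE) index_cat mem_enum inE ltnn andbF /= eqxx addn0.
  by [].
have takeE : take i (enum E) = enum (before x E).
  by rewrite (enum_split xE) -szi take_size_cat.
have dropE : drop i.+1 (enum E) = enum (after x E).
  by rewrite (enum_split xE) -szi -cat_rcons drop_size_cat // size_rcons.
have beforeE : before x E \subset E by apply/subsetP => y; rewrite inE => /andP[].
have afterE : after x E \subset E by apply/subsetP => y; rewrite inE => /andP[].
rewrite takeE dropE gE // -IH; first last.
- by move=> D DR; apply/gE/(subset_trans DR).
- rewrite -ltnS; apply: leq_trans ltk; rewrite ltnS; apply: proper_card.
  by apply/properP; split; last by exists x; rewrite // inE ltnn andbF.
rewrite mulr_sumr (reindex_onto (fun V => x |: V) (fun V => V :\ x)) /=; last first.
  move=> V /andP[/andP[_ V0] /eqP hV]; rewrite setD1K // -mem_enum -hV.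
  case defV: (enum V) => [|y u] /=; last exact: mem_head.
  by case/set0Pn: V0 => y; rewrite -mem_enum defV.
have ltx V : V \subset after x E -> forall y, y \in V -> (x < y)%N.
  by move=> /subsetP VE y /VE; rewrite inE => /andP[].
have minV V : (x |: V \subset E) && (x |: V != set0) && (head x0 (enum (x |: V)) == x)
     && ((x |: V) :\ x == V) -> V \subset after x E.
  case/andP=> /andP[/andP[VE _] /eqP hV] /eqP EV.
  rewrite -EV; apply/subsetP => y; rewrite !inE => /andP[ynex /orP[/eqP yx|yV]].
    by rewrite yx eqxx in ynex.
  have yE : y \in E by apply: (subsetP VE); rewrite !inE yV orbT.
  rewrite yE /=; have : y \in x |: V by rewrite !inE yV orbT.
  move: (sorted_enum_ord (x |: V)); rewrite -mem_enum.
  case: (enum _) hV => //= z u -> zu; rewrite inE (negPf ynex) /= => yu.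
  have ltt : transitive (fun i j : 'I_n => (i < j)%N) by move=> ? ? ?; apply: ltn_trans.
  by have /allP/(_ y yu) := order_path_min ltt zu.
apply: eq_big => [V|V].
  apply/idP/idP => [|VR]; first exact: minV.
  have ltV := ltx V VR; rewrite (enum_min ltV) /= eqxx andbT.
  rewrite setU1K; last by apply/negP => /ltV; rewrite ltnn.
  rewrite eqxx andbT subUset sub1set xE (subset_trans VR) //=.
  by apply/set0Pn; exists x; rewrite setU11.
by move=> /minV VR; rewrite (enum_min (ltx V VR)) weight_gap // mulrCA.
Qed.

(** Both sides solve the equation of the flow, and its solution is unique. *)
Lemma nc_sum_flow E : nc_sum E = flow h (enum E).
Proof.
have [k] := ubnP #|E|; elim: k E => // k IH E ltk.
apply: deriv_inj; last first.
  rewrite nc_sum_at0 flow_at0 /conv_unit /nilp -cardE -cards_eq0.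
  by [].
rewrite deriv_nc_sum deriv_flow.
(* On the whole of [E] the claim is not yet known, but [cumulant_poly] vanishes on the
   empty word, so the value of [g] there may be chosen freely. *)
pose g u := if (size u < #|E|)%N then flow h u else nc_sum E.
transitivity (conv (cumulant_poly h) g g (enum E)).
  rewrite -conv_nc_sum.
    rewrite [RHS](bigD1 set0) ?sub0set //= enum_set0 cumulant_poly_nil mul0r add0r.
    apply: eq_bigr => V /andP[_ V0]; congr (_ * _); rewrite /cumulant_poly.
    case defV: (enum V) => [|x u] //.
    by case/set0Pn: V0 => x; rewrite -mem_enum defV.
  move=> D DE; rewrite /g -cardE; case: ltnP => [ltD|leD].
    by rewrite IH // -ltnS (leq_trans _ ltk).
  by congr nc_sum; apply/esym/eqP; rewrite eqEcard DE.
apply: eq_conv_lt (cumulant_poly_nil _) _ _ => // u ltu; by rewrite /g cardE ltu.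
Qed.

End PartitionSums.

(** * The partition of a Schroder tree *)

Local Open Scope nat_scope.

Section TreeBlocks.

Lemma mem_adjacent_lcas_forest ss i j p :
    j < size ss -> p \in sectors (nth (Node [::]) ss j) ->
  (i + j) :: p \in adjacent_lcas (forest_addresses i (map leaves ss)).
Proof.
elim: ss i j => // s [|s' ss] IH i [|j] //.
- by move=> _ ps; rewrite adjacent_lcas_tree addn0 map_f.
- by move=> _ ps; rewrite adjacent_lcas_forest addn0 mem_cat map_f.
rewrite [size _]/= ltnS => ltj pj;
  rewrite adjacent_lcas_forest mem_cat inE addnS -addSn IH //.
by rewrite !orbT.
Qed.

(** An internal vertex of a Schroder tree has two consecutive children, and the sector
between them is labelled by the vertex. This is where unary vertices are excluded. *)
Lemma sectors_internal t : is_schroder t -> {subset internal_vertices t <= sectors t}.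
Proof.
elim/tree_ind': t => ss IH /andP[ss_gt1 ssS] v.
have [->|ss0] := eqVneq ss [::]; first by rewrite internal_vertices_leaf.
have {}ss_gt1 : 1 < size ss by case: (ss) ss0 ss_gt1.
rewrite internal_vertices_Node // /sectors leaves_Node // inE => /predU1P[->|].
  by case: (ss) ss_gt1 => [|s [|s' ss']] // _;
    rewrite adjacent_lcas_forest mem_cat inE eqxx orbT.
case: v => [|j p]; first by rewrite mem_forest_addresses_nil.
rewrite mem_forest_addresses_cons subn0 /=.
have [ltj|lej] := ltnP j (size ss); last by rewrite nth_default // size_map.
rewrite (nth_map (Node [::])) // => piv.
apply: (@mem_adjacent_lcas_forest ss 0) => //; apply: IH => //.
by move/all_nthP: ssS; apply.
Qed.

Lemma nth_sectors t i : i < (size (leaves t)).-1 ->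
  nth [::] (sectors t) i = lca (nth [::] (leaves t) i) (nth [::] (leaves t) i.+1).
Proof. by rewrite /sectors /adjacent_lcas; case: (leaves t) => //= u X lti;
  rewrite (nth_pairmap [::]). Qed.

Variables (n : nat) (t : tree).
Hypotheses (tS : is_schroder t) (tn : size (leaves t) = n.+1).

Lemma mem_sector_block v (i : 'I_n) :
  (i \in sector_block n t v) = (nth [::] (sectors t) i == v).
Proof. by rewrite inE nth_sectors // tn. Qed.

Lemma map_enum_sector_block (A : Type) (a : 'I_n -> A) v :
  map a (enum (sector_block n t v))
  = mask (map (pred1 v) (sectors t)) (map a (enum 'I_n)).
Proof.
have -> : enum (sector_block n t v) = [seq i <- enum 'I_n | i \in sector_block n t v].
  by rewrite enumT.
rewrite filter_mask map_mask; congr mask.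
have szs : size (sectors t) = n by rewrite size_adjacent_lcas tn.
apply: (@eq_from_nth _ false); rewrite size_map size_enum_ord ?size_map ?szs // => i lti.
rewrite (nth_map (Ordinal lti)) ?size_enum_ord // (nth_map [::]) ?szs //=.
by rewrite mem_sector_block nth_enum_ord.
Qed.

(** The blocks of distinct internal vertices are distinct since they are nonempty, so
that products over vertices and over blocks agree. *)
Lemma uniq_sector_blocks :
  uniq [seq sector_block n t v | v <- internal_vertices t].
Proof.
rewrite map_inj_in_uniq; first by rewrite filter_uniq ?uniq_vertices.
move=> v v' /(sectors_internal tS) vs _ E.
have lti : index v (sectors t) < n by rewrite -[n]/(n.+1.-1) -tn -size_adjacent_lcas
  index_mem.
have : Ordinal lti \in sector_block n t v by rewrite mem_sector_block /= nth_index.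
by rewrite E mem_sector_block /= nth_index // => /eqP.
Qed.

End TreeBlocks.

(** * Monotone cumulants in terms of moments *)

Local Open Scope ring_scope.

Section Functionals.
Variables (R : realType) (A : algType R[i]).
Implicit Types (f : functional_family A) (w : seq A).

(** The default 0 of [nth] is never reached. Words have a plain type where families
indexed by {0, ..., n - 1} have a dependent one. *)
Definition word_functional f w : R[i] := f (size w) [ffun j : 'I_(size w) => nth 0 w j].

(** Avoids transports along equalities between lengths. *)
Lemma functional_family_cast f n k (a : {ffun 'I_n -> A}) (b : {ffun 'I_k -> A}) :
  n = k -> (forall (i : 'I_n) (j : 'I_k), i = j :> nat -> a i = b j) -> f n a = f k b.
Proof.
move=> E; case: _ / E b => b ab.
by congr (f n _); apply/ffunP => i; apply: ab.
Qed.

Lemma partition_functionalE f n (P : {set {set 'I_n}}) (a : {ffun 'I_n -> A}) :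
  partition_functional f P a = \prod_(V in P) word_functional f (map a (enum V)).
Proof.
apply: eq_bigr => V _; apply: functional_family_cast => [|i j Eij].
  by rewrite size_map cardE.
rewrite !ffunE (nth_map (enum_default i)) -?cardE -?Eij //.
Qed.

Lemma word_functional_enum f n (a : {ffun 'I_n -> A}) :
  word_functional f (map a (enum 'I_n)) = f n a.
Proof.
apply: functional_family_cast => [|i j Eij]; first by rewrite size_map size_enum_ord.
rewrite ffunE (nth_map j) ?size_enum_ord ?Eij //; congr (a _); apply: val_inj.
by rewrite /= nth_enum_ord ?Eij.
Qed.

Lemma word_moment (phi : {scalar A}) w :
  word_functional (moment phi) w = phi (\prod_(x <- w) x).
Proof.
rewrite /word_functional /moment (big_nth 0) big_mkord; congr (phi _).
by apply: eq_bigr => i _; rewrite ffunE.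
Qed.

(** The defining equation of the monotone cumulants, for a word of length n, is the
noncrossing sum over all n positions at X = 1. *)
Lemma flow_moment (phi : {scalar A}) (h : functional_family A) w :
    phi 1 = 1 -> monotone_cumulants phi h ->
  (flow (word_functional h) w).[1] = word_functional (moment phi) w.
Proof.
move=> phi1 [_ hE]; case: w => [|x w].
  by rewrite flow_nil hornerC word_moment big_nil.
set u := x :: w; rewrite [RHS]hE //; set a := [ffun _ => _].
have Eu : u = map a (enum 'I_(size u)).
  apply: (@eq_from_nth _ 0) => [|i lti]; first by rewrite size_map size_enum_ord.
  by rewrite (nth_map (Ordinal lti)) ?size_enum_ord // ffunE nth_enum_ord.
rewrite {1}Eu flow_map.
pose h' v := word_functional h (map a v).
have -> : enum 'I_(size u) = enum [set: 'I_(size u)].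
  by apply: eq_enum => i; rewrite in_setT.
rewrite -(nc_sum_flow h') horner_sum; apply: eq_bigr => P PNC.
rewrite hornerZ hornerXn expr1n mulr1 big_split /= mulrC prodfV -natr_prod.
by rewrite forest_fact_hook // partition_functionalE.
Qed.

End Functionals.

Theorem theorem1p1 (R : realType) (A : algType R[i]) (phi : {scalar A})
    (phi1 : phi 1 = 1) (h : functional_family A)
    (h_cumulants : monotone_cumulants phi h)
    (n : nat) (n_gt0 : (0 < n)%N) (a : {ffun 'I_n -> A}) :
  h n a = \sum_(t : schroder_tree n)
    ratr (murua (skeleton t)) *
    partition_functional (moment phi) (tree_partition n t) a.
Proof.
have szw : size (map a (enum 'I_n)) = n by rewrite size_map size_enum_ord.
rewrite -word_functional_enum.
rewrite (log_flow (m := word_functional (moment phi))); first last.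
- by rewrite szw.
- by move=> w; apply: flow_moment.
- by rewrite word_moment big_nil.
rewrite /tree_sum szw; apply: eq_bigr => t _; congr (_ * _).
have /andP[tS /eqP tn] := valP t.
rewrite partition_functionalE /tree_partition.
rewrite (eq_bigl (mem [seq sector_block n t v | v <- internal_vertices t])) => [|V].
  rewrite -big_uniq ?uniq_sector_blocks // big_map; apply: eq_bigr => v _.
  by rewrite (map_enum_sector_block tn).
by rewrite inE.
Qed.
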